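(* Let $\{X_t\}_{t\ge0}$ be a Lévy process on $\mathbb{R}^d$ with transition semigroup $T_tu(x)=\int_{\mathbb{R}^d}u(x+y)\,\mu_t(dy)$. Then the following two statements are equivalent: (1) The process $\{X_t\}_{t\ge0}$ has the strong Feller property; (2) For every $t>0$, there exist some Young function $\Phi_t:\mathbb{R}\to[0,\infty)$ such that $\Phi_t(x)=0$ if and only if $x=0$ and a constant $C(t)<\infty$ such that for all $u\in C_c^\infty(\mathbb{R}^d)$, $$\|T_tu\|_\infty\le C(t)\|u\|_{\Phi_t},$$ where $\|\cdot\|_{\Phi_t}$ denotes the norm of the Orlicz space $\mathbb{L}^{\Phi_t}(\mathrm{Leb})$.
   Context: A Lévy process is a stochastic process with independent and stationary increments (and càdlàg paths); $\mu_t$ is the law of $X_t$ started at $0$, so $\{\mu_t\}_{t\ge0}$ is a (weakly continuous) convolution semigroup on $\mathbb{R}^d$ and $P_t(x,\cdot)=\mu_t(\cdot-x)$. Strong Feller property: $T_tf$ is bounded and continuous for every bounded Borel function $f$ and every $t>0$. A Young function is a convex, even function $\Phi$ with $\Phi(0)=0$ and $\lim_{x\to\infty}\Phi(x)=\infty$. $\mathbb{L}^\Phi(\mathrm{Leb})=\{f\text{ measurable}:\int\Phi(\alpha f)\,dx<\infty\text{ for some }\alpha>0\}$ (Lebesgue measure) with Orlicz norm $\|f\|_\Phi=\sup\{\int|fg|\,dx:\int\Phi_c(g)\,dx\le1\}$, where $\Phi_c(y)=\sup_{x\ge0}(x|y|-\Phi(x))$. *)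

(* Defs.v *)
From HB Require Import structures.
From mathcomp Require Import all_boot all_order all_algebra.
From mathcomp Require Import all_classical all_reals all_analysis.

Set Implicit Arguments.
Unset Strict Implicit.
Unset Printing Implicit Defensive.

Import Order.TTheory GRing.Theory Num.Theory.
Import numFieldNormedType.Exports.

Local Open Scope classical_set_scope.
Local Open Scope ring_scope.

(* R^n is 'rV[R]_n with its library topology (max-norm, hence the usual one)
   and the Borel sigma-algebra generated by the open sets. *)
HB.instance Definition _ (R : realType) (n : nat) :=
  @isMeasurable.Build (sigma_display (@open 'rV[R]_n)) 'rV[R]_n
    <<s @open 'rV[R]_n >> (@sigma_algebra0 _ _ _) (@sigma_algebraC _ _)
    (@sigma_algebra_bigcup _ _ _).

Section borel_rV.
Context {R : realType}.

Lemma open_measurable_rV n (U : set 'rV[R]_n) : open U -> measurable U.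
Proof. by move=> oU; exact: sub_sigma_algebra. Qed.

Lemma measurable_coord n (i : 'I_n) :
  measurable_fun [set: 'rV[R]_n] (fun v : 'rV[R]_n => v ord0 i).
Proof.
apply: (measurability _ (measurable_realfun.RGenOpens.measurableE R)).
move=> _ [_ [a [b ->]] <-]; rewrite setTI.
apply: open_measurable_rV; apply: open_comp; last exact: interval_open.
by move=> v _; exact: coord_continuous.
Qed.

Lemma rat_near (x e : R) : 0 < e -> exists q : rat, `|x - ratr q| < e.
Proof.
move=> e0; have [|q] := @rat_in_itvoo R (x - e) (x + e).
  by rewrite ltrD2l (lt_trans _ e0)// oppr_lt0.
by rewrite in_itv/= => /andP[qe xq]; exists q; rewrite distrC ltr_distl qe xq.
Qed.

Let rball n (p : 'rV[rat]_n * rat) : set 'rV[R]_n :=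
  [set v | forall i, `|v ord0 i - ratr (p.1 ord0 i)| < ratr p.2].

Lemma open_rV_bigcup n (U : set 'rV[R]_n) : open U ->
  U = \bigcup_(p in [set p | 0 < p.2 /\ rball p `<=` U]) rball p.
Proof.
move=> oU; apply/seteqP; split => [x Ux|x [p [_ pU]]]; last exact: pU.
have /nbhs_ballP[e /= e0 xeU] : nbhs x U by exact: open_nbhs_nbhs.
have [r] : exists q : rat, ratr q \in `]0, e / 2[.
  by apply: rat_in_itvoo; rewrite divr_gt0.
rewrite in_itv/= => /andP[r0 re].
have /choice[q qr] : forall i, exists q : rat, `|x ord0 i - ratr q| < ratr r.
  by move=> i; exact: rat_near.
exists (\row_i q i, r) => /=; last by move=> i; rewrite mxE.
split; first by rewrite -(ltr0q R).
move=> v /= vr; apply: xeU; split => // i j; rewrite ord1 /ball/= (splitr e).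
have := vr j; rewrite mxE => vj.
rewrite (le_lt_trans (ler_distD (ratr (q j)) _ _))// ltrD//.
  exact: lt_trans (qr j) re.
by rewrite distrC (lt_trans vj).
Qed.

Lemma measurable_fun_rV d (T : measurableType d) n (f : T -> 'rV[R]_n) :
  (forall i, measurable_fun [set: T] (fun x => f x ord0 i)) ->
  measurable_fun [set: T] f.
Proof.
move=> mf; apply: (measurability (@open 'rV[R]_n)) => //.
move=> _ [U oU <-]; rewrite setTI (open_rV_bigcup oU) preimage_bigcup.
rewrite bigcup_mkcond; apply: countable_bigcupT_measurable => //= p.
case: ifPn => // _.
have -> : f @^-1` rball p = \bigcap_(i in [set: 'I_n])
    (fun x => f x ord0 i) @^-1` (ball (ratr (p.1 ord0 i) : R) (ratr p.2) : set R).
  by apply/seteqP; split => x /= H i; [move=> _|];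
    have := H i; rewrite /ball/= distrC => H'; exact: H'.
apply: fin_bigcap_measurable => // i _.
rewrite -[X in measurable X]setTI; apply: mf => //.
by apply: measurable_realfun.open_measurable; exact: ball_open.
Qed.

Definition cons_rV n (p : R * 'rV[R]_n) : 'rV[R]_n.+1 :=
  row_mx (p.1%:M : 'rV[R]_1) p.2.

Lemma measurable_cons_rV n : measurable_fun [set: R * 'rV[R]_n] (@cons_rV n).
Proof.
apply: measurable_fun_rV => i.
have [j ->|j ->] := split_ordP (i : 'I_(1 + n)).
  rewrite (_ : (fun _ => _) = fst) //.
  by apply/funext => p /=; apply: etrans (row_mxEl _ _ _ _) _; rewrite !ord1 mxE eqxx.
rewrite (_ : (fun _ => _) = (fun v : 'rV[R]_n => v ord0 j) \o snd).
  by apply: measurableT_comp => //; exact: measurable_coord.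
by apply/funext => p /=; exact: row_mxEr.
Qed.

End borel_rV.

(* Lebesgue measure on R^n, as the n-fold product of the one on R.  \x^ is the
   variant of the product that only needs the left factor to be sigma-finite;
   it agrees with \x when both factors are. *)
Fixpoint lebesgue_rV (R : realType) (n : nat) : set 'rV[R]_n -> \bar R :=
  if n is m.+1 then
    pushforward (lebesgue_measure \x^ @lebesgue_rV R m)%E (@cons_rV R m)
  else \d_(0 : 'rV[R]_0).

Section lebesgue_rV_measure.
Context (R : realType) (n : nat).

Let lebesgue_rV_measure :
  exists mu : {measure set 'rV[R]_n -> \bar R}, lebesgue_rV (n := n) = mu.
Proof.
elim: n => [|m [mu muE]]; first by exists \d_(0 : 'rV[R]_0).
by exists (measure_function_pushforward__canonical__measure_function_Measure
  (lebesgue_measure \x^ mu)%E (@measurable_cons_rV R m)); rewrite /= muE.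
Qed.

Let leb0 : lebesgue_rV (set0 : set 'rV[R]_n) = 0%E.
Proof. by have [mu ->] := lebesgue_rV_measure; exact: measure0. Qed.

Let leb_ge0 (A : set 'rV[R]_n) : (0 <= lebesgue_rV A)%E.
Proof. by have [mu ->] := lebesgue_rV_measure; exact: measure_ge0. Qed.

Let leb_sigma_additive : semi_sigma_additive (@lebesgue_rV R n).
Proof.
by have [mu ->] := lebesgue_rV_measure; exact: measure_semi_sigma_additive.
Qed.

HB.instance Definition _ := isMeasure.Build _ _ _ (@lebesgue_rV R n)
  leb0 leb_ge0 leb_sigma_additive.

End lebesgue_rV_measure.

Section levy.
Context {R : realType} {dO : measure_display} {Omega : measurableType dO}.
Variable P : probability Omega R.

Definition independent_rV (I : finType) n (Y : I -> Omega -> 'rV[R]_n) :=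
  forall (J : {set I}) (A : I -> set 'rV[R]_n), (forall i, measurable (A i)) ->
  P (\bigcap_(i in [set` J]) Y i @^-1` A i) =
  (\prod_(i in J) P (Y i @^-1` A i))%E.

Variables (d : nat) (X : R -> {RV P >-> 'rV[R]_d}).

(* Only the times t >= 0 are relevant: the values of X at negative times are
   unconstrained and never used. *)
Record levy_process : Prop := {
  levy_start : {ae P, forall w, X 0 w = 0} ;
  levy_independent : forall (n : nat) (t : nat -> R),
    0 <= t 0%N -> (forall k, t k <= t k.+1) ->
    independent_rV (fun (k : 'I_n) w => X (t k.+1) w - X (t k) w) ;
  levy_stationary : forall s h : R, 0 <= s -> 0 <= h ->
    forall A : set 'rV[R]_d, measurable A ->
    P [set w | A (X (s + h) w - X s w)] = P [set w | A (X h w - X 0 w)] ;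
  levy_cadlag : {ae P, forall w,
    (forall t : R, 0 <= t -> X s w @[s --> t^'+] --> X t w) /\
    (forall t : R, 0 < t -> cvg (X s w @[s --> t^'-])) }
}.

(* T_t u (x) = \int u (x + y) mu_t(dy), where mu_t is the law of X_t. *)
Definition transition (t : R) (u : 'rV[R]_d -> R) (x : 'rV[R]_d) : R :=
  \int[distribution P (X t)]_y u (x + y).

Definition strong_feller := forall t : R, 0 < t ->
  forall f : 'rV[R]_d -> R, measurable_fun setT f -> bounded_fun f ->
  bounded_fun (transition t f) /\ continuous (transition t f).

End levy.

Section orlicz.
Context {R : realType}.

Record young_function (Phi : R -> R) : Prop := {
  young_convex : convex_function setT (Phi : R^o -> R^o) ;
  young_even : forall x, Phi (- x) = Phi x ;
  young_0 : Phi 0 = 0 ;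
  young_pinfty : Phi x @[x --> +oo] --> +oo
}.

(* The supremum may be +oo, e.g. when Phi has linear growth. *)
Definition young_conjugate (Phi : R -> R) (y : R) : \bar R :=
  ereal_sup [set (x * `|y| - Phi x)%:E | x in [set x | 0 <= x]].

Definition orlicz_norm (d : nat) (Phi : R -> R) (f : 'rV[R]_d -> R) : \bar R :=
  ereal_sup [set (\int[@lebesgue_rV R d]_x `|f x * g x|%:E)%E |
    g in [set g : 'rV[R]_d -> R | measurable_fun setT g /\
      (\int[@lebesgue_rV R d]_x young_conjugate Phi (g x) <= 1)%E]].

End orlicz.

Section test_functions.
Context {R : realType} {d : nat}.

(* C_k k f: all iterated partial derivatives of f of order at most k exist
   everywhere and are continuous. *)
Fixpoint C_k (k : nat) (f : 'rV[R]_d -> R) : Prop :=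
  if k is k'.+1 then
    continuous f /\ forall i : 'I_d,
      (forall x, derivable f x (delta_mx 0 i)) /\ C_k k' ('D_(delta_mx 0 i) f)
  else continuous f.

Definition Cc_infty (f : 'rV[R]_d -> R) :=
  (forall k, C_k k f) /\ compact (closure [set x | f x != 0]).

(* The supremum itself, not an essential supremum. *)
Definition sup_norm (f : 'rV[R]_d -> R) : \bar R :=
  ereal_sup [set `|f x|%:E | x in setT].

End test_functions.

(* Main.v *)
(* For a fixed [t > 0] let [mu] be the law of [X t], so that [T_t u] is the
   convolution [x |-> \int u (x + y) mu(dy)]; nothing else about the process is
   needed.

   Strong Feller => Orlicz bound.  If [A] is Lebesgue-null then, by Tonelli and
   translation invariance, [T_t 1_A] has integral 0; being continuous it vanishes
   everywhere, so [mu A = 0].  Let [q] be the density of [mu], and choose levels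
   [N_k >= 1] with [mu {q > N_k} <= 2^-(k+1)].  For
   [Phi a = sup_k N_k (|a| - k)^+] the conjugate satisfies
   [Phi_c y <= y #{k | N_k < y}], hence
   [\int Phi_c(q) dx <= \sum_k mu {q > N_k} <= 1].  As
   [|T_t u (x)| <= \int |u z| q (z - x) dz], the bound holds with constant 1.

   Orlicz bound => strong Feller.  For open [V], smooth functions increasing to
   the indicator of [V] and Young's inequality give
   [mu (V - x) <= C (Phi a |V| + 1) / a] for all [a > 0], which is small,
   uniformly in [x], when [a] is large and then [|V|] small.  By regularity of
   Lebesgue measure and Urysohn's lemma, [T_t 1_A] is then locally a uniform
   limit of functions [T_t g] with [g] continuous and bounded, hence continuous;
   bounded Borel functions follow by uniform approximation. *)

From HB Require Import structures.
Require Import Defs.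
From mathcomp Require Import all_boot all_order all_algebra.
From mathcomp Require Import all_classical all_reals all_analysis.
From mathcomp Require Import measurable_realfun ring lra.

Set Implicit Arguments.
Unset Strict Implicit.
Unset Printing Implicit Defensive.

Import Order.TTheory GRing.Theory Num.Theory.
Import numFieldNormedType.Exports.

Local Open Scope classical_set_scope.
Local Open Scope ring_scope.

(** * Lebesgue measure on R^n *)

Section lebesgue_rV_facts.
Context {R : realType}.

Lemma lebesgue_rVSE n (A : set 'rV[R]_n.+1) :
  lebesgue_rV A = (\int[@lebesgue_rV R n]_v
    (@lebesgue_measure R) (ysection (@cons_rV R n @^-1` A) v))%E.
Proof. by []. Qed.

Lemma cons_rV_head n (p : R * 'rV[R]_n) : cons_rV p ord0 ord0 = p.1.
Proof.
rewrite /cons_rV (_ : ord0 = @lshift 1 n ord0); last exact/val_inj.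
by apply: etrans (row_mxEl _ _ _ _) _; rewrite mxE eqxx.
Qed.

Lemma cons_rV_tail n (p : R * 'rV[R]_n) i :
  cons_rV p ord0 (lift ord0 i) = p.2 ord0 i.
Proof.
rewrite /cons_rV (_ : lift ord0 i = @rshift 1 n i); last exact/val_inj.
exact: row_mxEr.
Qed.

Lemma cons_rVK n (v : 'rV[R]_n.+1) :
  cons_rV (v ord0 ord0, \row_i v ord0 (lift ord0 i)) = v.
Proof.
apply/rowP => i; have [->|[j ->]] : i = ord0 \/ exists j, i = lift ord0 j.
- by case: (unliftP ord0 i) => [j|] ->; [right; exists j|left].
- by rewrite cons_rV_head.
- by rewrite cons_rV_tail mxE.
Qed.

Lemma cons_rVD n (p q : R * 'rV[R]_n) :
  cons_rV p + cons_rV q = cons_rV (p.1 + q.1, p.2 + q.2).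
Proof.
apply/rowP => i; rewrite [LHS]mxE; case: (unliftP ord0 i) => [j|] ->.
- by rewrite !cons_rV_tail mxE.
- by rewrite !cons_rV_head.
Qed.

Lemma ball_rVE n (c : 'rV[R]_n) (r : R) : 0 < r ->
  ball c r = [set v | forall i, ball (c ord0 i) r (v ord0 i)].
Proof.
move=> r0; apply/seteqP; split => [v [_ h] i|v h]; first exact: h.
by split => // i j; rewrite ord1.
Qed.

Lemma measurable_ball_rV n (c : 'rV[R]_n) (r : R) : measurable (ball c r).
Proof. by apply: open_measurable_rV; exact: ball_open. Qed.

(** A max-norm ball is a cube of side [r *+ 2], so its preimage under [cons_rV] is an interval times
    a ball of one dimension less. In dimension 0 the space is a single point of mass 1. *)
Lemma lebesgue_rV_ball n (c : 'rV[R]_n) (r : R) : 0 < r ->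
  lebesgue_rV (ball c r) = ((r *+ 2) ^+ n)%:E.
Proof.
move=> r0; elim: n c => [|n IH] c.
  by rewrite /lebesgue_rV /= expr0 (thinmx0 c) diracE mem_set//; exact: ballxx.
transitivity ((lebesgue_measure \x^ @lebesgue_rV R n)%E
    (@cons_rV R n @^-1` ball c r)) => //.
rewrite (_ : _ @^-1` _ = ball (c ord0 ord0) r `*`
    ball (\row_j c ord0 (lift ord0 j)) r).
  rewrite product_measure2E//; last 2 first.
  - by apply: measurable_realfun.open_measurable; exact: ball_open.
  - exact: measurable_ball_rV.
  rewrite [X in (_ * X)%E](IH (\row_j c ord0 (lift ord0 j))).
  by rewrite [X in (X * _)%E](lebesgue_measure_ball _ (ltW r0)) -EFinM exprS.
rewrite !ball_rVE//; apply/seteqP; split => -[s v] /=.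
  move=> h; split; first by have := h ord0; rewrite cons_rV_head.
  by move=> i; rewrite mxE; have := h (lift ord0 i); rewrite cons_rV_tail.
move=> [h1 h2] i; case: (unliftP ord0 i) => [j|] ->.
- by rewrite cons_rV_tail; have := h2 j; rewrite mxE.
- by rewrite cons_rV_head.
Qed.

Lemma bigcup_ball_rV n : \bigcup_k ball (0 : 'rV[R]_n) k.+1%:R = setT.
Proof.
apply/seteqP; split => // v _; exists (Num.truncn `|v|) => //.
by rewrite -ball_normE /ball_ /= sub0r normrN truncnS_gt.
Qed.

Lemma lebesgue_rV_sigma_finite n :
  sigma_finite [set: 'rV[R]_n] (@lebesgue_rV R n).
Proof.
exists (fun k => ball (0 : 'rV[R]_n) k.+1%:R); first by rewrite bigcup_ball_rV.
move=> k; split; first exact: measurable_ball_rV.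
by rewrite lebesgue_rV_ball// ltry.
Qed.

HB.instance Definition _ n := Measure_isSigmaFinite.Build _ _ _
  (@lebesgue_rV R n) (@lebesgue_rV_sigma_finite n).

(** * Translation invariance *)

Lemma integral_invariant d (T : measurableType d)
    (mu : {measure set T -> \bar R}) (phi : T -> T) (f : T -> \bar R) :
  measurable_fun setT phi ->
  (forall A, measurable A -> mu (phi @^-1` A) = mu A) ->
  measurable_fun setT f -> (forall x, (0 <= f x)%E) ->
  (\int[mu]_x f (phi x) = \int[mu]_x f x)%E.
Proof.
move=> mphi phimu mf f0.
rewrite -[LHS](ge0_integral_pushforward mphi mu measurableT)//.
by apply: eq_measure_integral => A mA _; exact: phimu.
Qed.

(** By uniqueness of Lebesgue measure: the image measure agrees with it on half-open intervals. *)
Lemma lebesgue_measure_shift (a : R) (A : set R) : measurable A ->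
  lebesgue_measure ((fun x => x + a) @^-1` A) = lebesgue_measure A.
Proof.
have mphi : measurable_fun setT
    ((fun x : measurableTypeR R => x + a) : _ -> measurableTypeR R).
  exact: measurable_funD.
move=> mA; apply/esym.
apply: (@lebesgue_measure_unique R
  (measure_function_pushforward__canonical__measure_function_Measure
    (@lebesgue_measure R) mphi)) => //= _ [[x y]] _ <-.
rewrite /pushforward (_ : _ @^-1` _ = `]x - a, y - a]%classic).
  rewrite !lebesgue_measure_itv/= !lte_fin ltrD2r -!EFinB.
  by congr (if _ then _ else _); congr EFin; lra.
by apply/seteqP; split => z /=; rewrite !in_itv/= ltrBlDr lerBrDr.
Qed.

Lemma measurable_shift_rV n (a : 'rV[R]_n) :
  measurable_fun setT (fun v : 'rV[R]_n => v + a).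
Proof.
apply: measurable_fun_rV => i; under eq_fun do rewrite mxE.
by apply: measurable_funD => //; exact: measurable_coord.
Qed.

(** Induction on the dimension: one-dimensional invariance absorbs the head of the shift in each
    section, and the induction hypothesis absorbs the tail through [integral_invariant]. *)
Lemma lebesgue_rV_shift n (a : 'rV[R]_n) (A : set 'rV[R]_n) : measurable A ->
  lebesgue_rV ((fun v => v + a) @^-1` A) = lebesgue_rV A.
Proof.
elim: n a A => [|n IH] a A mA.
  congr lebesgue_rV; apply/seteqP; split => v /=;
    by rewrite (thinmx0 v) (thinmx0 a) addr0.
have mB : measurable (@cons_rV R n @^-1` A).
  by rewrite -[X in measurable X]setTI; exact: measurable_cons_rV.
set a' := \row_i a ord0 (lift ord0 i).
transitivity (\int[@lebesgue_rV R n]_v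
    (@lebesgue_measure R) (ysection (@cons_rV R n @^-1` A) (v + a')%R))%E.
  rewrite [LHS]lebesgue_rVSE; apply: eq_integral => v _ /=.
  rewrite -[RHS](lebesgue_measure_shift (a ord0 ord0)); last exact: measurable_ysection.
  congr lebesgue_measure; apply/seteqP; split => s; rewrite /ysection /= !inE /=;
    by rewrite (_ : cons_rV (s, v) + a = cons_rV (s + a ord0 ord0, v + a'))//
      -[in LHS](cons_rVK a) cons_rVD.
have := @integral_invariant _ _ (@lebesgue_rV R n) (fun v => v + a')
  (fun v => lebesgue_measure (ysection (@cons_rV R n @^-1` A) v))
  (measurable_shift_rV a') (IH a').
apply => //.
by have := measurable_fun_ysection (@lebesgue_measure R) mB.
Qed.

Lemma integral_lebesgue_rV_shift n (a : 'rV[R]_n) (f : 'rV[R]_n -> \bar R) :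
  measurable_fun setT f -> (forall x, (0 <= f x)%E) ->
  (\int[@lebesgue_rV R n]_x f (x + a)%R = \int[@lebesgue_rV R n]_x f x)%E.
Proof.
move=> mf f0; have := @integral_invariant _ _ (@lebesgue_rV R n) (fun v => v + a) f
  (measurable_shift_rV a); apply => //.
by move=> A mA; exact: lebesgue_rV_shift.
Qed.

End lebesgue_rV_facts.

(** * Smooth bump functions *)

Section smooth_bumps.
Context {R : realType}.

Lemma cvg_is_derive (V : normedModType R) (f : V -> R) (x v : V) (l : R) :
  (fun h : R => h^-1 *: ((f \o shift x) (h *: v) - f x)) @ 0^' --> l ->
  is_derive x v f l.
Proof. by move=> h; split; [exact: cvgP h|exact: cvg_lim h]. Qed.

Lemma is_derive_cvg (V : normedModType R) (f : V -> R) (x v : V) (l : R) :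
  is_derive x v f l ->
  (fun h : R => h^-1 *: ((f \o shift x) (h *: v) - f x)) @ 0^' --> l.
Proof. by case=> h <-. Qed.

(** Reduces a directional derivative to one real variable, where the chain rule applies. *)
Lemma is_derive_along (V : normedModType R) (f : V -> R) (x v : V) (l : R) :
  is_derive (0 : R) (1 : R) (fun h : R => f (h *: v + x)) l -> is_derive x v f l.
Proof.
move=> /is_derive_cvg h; apply: cvg_is_derive; move: h.
set F := (X in X @ _); set G := (X in _ -> X @ _ --> _).
rewrite (_ : F = G)//; rewrite /F /G.
by apply/funext => h /=; rewrite addr0 scale0r add0r [_%:A]mulr1.
Qed.

Lemma near_is_derive (f g : R -> R) (x l : R) :
  (\forall y \near x, f y = g y) -> is_derive x 1 f l -> is_derive x 1 g l.
Proof.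
move=> fg /is_derive_cvg fl; apply: cvg_is_derive.
apply: cvg_trans fl; apply: near_eq_cvg; near=> h.
rewrite (nbhs_singleton fg) /=; congr (_ *: (_ - _)).
rewrite [_%:A]mulr1; near: h; apply: nbhs_dnbhs.
have : (fun h : R => h + x) @ (0:R) --> x.
  by rewrite -[X in _ --> X]add0r; apply: cvgD; [exact: cvg_id|exact: cvg_cst].
by move=> /(_ _ fg).
Unshelve. all: by end_near. Qed.

(* The functions [fun t => t^-k * exp (-1/t)], extended by 0, are stable under
   differentiation up to linear combinations. *)
Definition flat (k : nat) (t : R) : R :=
  if 0 < t then t^-1 ^+ k * expR (- t^-1) else 0.

Lemma flat_ge0 k t : 0 <= flat k t.
Proof.
rewrite /flat; case: ifPn => // t0.
by rewrite mulr_ge0 ?expR_ge0// exprn_ge0// invr_ge0 ltW.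
Qed.

Lemma flat_gt0 k t : 0 < t -> 0 < flat k t.
Proof. by move=> t0; rewrite /flat t0 mulr_gt0 ?expR_gt0// exprn_gt0// invr_gt0. Qed.

Lemma flat_le0 k t : t <= 0 -> flat k t = 0.
Proof. by move=> t0; rewrite /flat ltNge t0. Qed.

Lemma flat0_le1 t : flat 0 t <= 1.
Proof.
rewrite /flat; case: ifPn => // t0.
by rewrite expr0 mul1r expR_le1 oppr_le0 invr_ge0 ltW.
Qed.

Lemma flat_bound k t : flat k t <= (k.+1)`!%:R * `|t|.
Proof.
rewrite /flat; case: ifPn => [t0|_]; last by rewrite mulr_ge0.
have s0 : 0 < t^-1 by rewrite invr_gt0.
rewrite gtr0_norm// expRN ler_pdivrMr ?expR_gt0//.
have /(le_trans _) := expR_ge1Dxn k (ltW s0) => /(_ (t^-1 ^+ k.+1 / k.+1`!%:R)).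
rewrite lerDr ler01 => /(_ isT) h.
rewrite (@le_trans _ _ (k.+1`!%:R * t * (t^-1 ^+ k.+1 / k.+1`!%:R)))//; last first.
  by rewrite ler_pM2l// mulr_gt0// ltr0n fact_gt0.
rewrite exprS; set F : R := k.+1`!%:R; set S := t^-1 ^+ k.
have F0 : F != 0 by rewrite pnatr_eq0 -lt0n fact_gt0.
rewrite le_eqVlt; apply/orP; left; apply/eqP; field.
by rewrite F0 gt_eqF.
Qed.

(** One formula covers three cases: everything vanishes for [t < 0], ordinary calculus applies for
    [t > 0], and the derivative at 0 is 0. *)
Lemma flat_derive k t :
  is_derive t (1 : R) (flat k) (flat k.+2 t - k%:R * flat k.+1 t).
Proof.
have [t0|t0|->] := ltgtP t 0.
- rewrite !flat_le0 ?ltW// mulr0 subr0.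
  apply: (@near_is_derive (cst 0)) => //.
  near=> y; rewrite /= flat_le0// ltW//; near: y; exact: lt_nbhsl.
- apply: (@near_is_derive (fun t => t^-1 ^+ k * expR (- t^-1))).
    near=> y; rewrite /flat ifT//; near: y; exact: lt_nbhsr.
  have tn0 : t != 0 by rewrite gt_eqF.
  have dV : is_derive t (1 : R) (fun t : R => t^-1) (- t ^- 2).
    split; first exact: (@derivableV _ _ id _ _ tn0 (@derivable_id _ _ _ _)).
    by rewrite (@deriveV _ _ id _ _ tn0 (@derivable_id _ _ _ _)) derive_id [_ *: 1]mulr1.
  have dE := is_derive1_comp (is_derive_expR _) (is_deriveN dV).
  have H := is_deriveM (is_deriveX k dV) dE.
  rewrite (_ : (fun t => _) =
    (fun t : R => t^-1) ^+ k * (expR \o - (fun t : R => t^-1))); last first.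
    by apply/funext => y; rewrite mulrfctE exprfctE.
  split; first by case: H.
  case: H => _ H; apply: etrans H _.
  rewrite /flat t0 exprfctE /= opprK -exprVn.
  set s := t^-1; set E := expR (- s).
  transitivity (s ^+ k * (E * s ^+ 2) + E * ((k%:R * s ^+ k.-1) * (- s ^+ 2))).
    by [].
  (* The power rule leaves the exponent [k.-1], truncated at [k = 0]; there the factor [k%:R] kills
     the term. *)
  case: k => [|k] /=; first by ring.
  rewrite !exprS; ring.
- rewrite !flat_le0// mulr0 subr0; apply: cvg_is_derive.
  rewrite flat_le0//.
  apply/cvgrPdist_le => /= e e0; near=> h.
  rewrite subr0 addr0 [_%:A]mulr1 sub0r normrN.
  have hn0 : h != 0 by near: h; exact: nbhs_dnbhs_neq.
  (* The difference quotient at 0 is again a flat function, which [flat_bound] sends to 0. *)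
  have -> : h^-1 *: flat k h = flat k.+1 h.
    by rewrite /flat; case: ifPn => _; rewrite ?scaler0// exprS -mulrA.
  rewrite ger0_norm ?flat_ge0// (le_trans (flat_bound _ _))//.
  rewrite -ler_pdivlMl ?ltr0n ?fact_gt0//.
  near: h; apply: dnbhs0_le; rewrite mulr_gt0// invr_gt0 ltr0n fact_gt0//.
Unshelve. all: by end_near. Qed.

Lemma continuous_flat k : continuous (flat k).
Proof.
move=> t; have [/derivable1_diffP h _] := flat_derive k t.
exact: differentiable_continuous.
Qed.

(** * Smooth functions of several variables *)

Context {d : nat}.
Implicit Types (f g : 'rV[R]_d -> R).

Lemma C_kW k f : C_k k.+1 f -> C_k k f.
Proof.
elim: k f => [|k IH] f; first by case.
by move=> [cf h]; split=> // i; have [df /IH] := h i.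
Qed.

Lemma C_k_cst k (c : R) : C_k k (fun _ : 'rV[R]_d => c).
Proof.
elim: k c => [|k IH] c /=; first exact: cst_continuous.
split; first exact: cst_continuous.
move=> i; split; first by move=> x; exact: derivable_cst.
rewrite (_ : 'D_(delta_mx 0 i) _ = fun=> 0); first exact: IH.
by apply/funext => x; exact: derive_cst.
Qed.

Lemma C_kD k f g : C_k k f -> C_k k g -> C_k k (f \+ g).
Proof.
elim: k f g => [|k IH] f g /=.
  by move=> cf cg x; exact: continuousD (cf x) (cg x).
move=> [cf hf] [cg hg]; split.
  by move=> x; exact: continuousD (cf x) (cg x).
move=> i; have [df Df] := hf i; have [dg Dg] := hg i.
split; first by move=> x; apply: derivableD.
rewrite (_ : 'D_(delta_mx 0 i) _ =
  'D_(delta_mx 0 i) f \+ 'D_(delta_mx 0 i) g); first exact: IH.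
by apply/funext => x; exact: deriveD.
Qed.

Lemma C_kM k f g : C_k k f -> C_k k g -> C_k k (f \* g).
Proof.
elim: k f g => [|k IH] f g.
  by move=> cf cg x; exact: continuousM (cf x) (cg x).
move=> Cf Cg; have [cf hf] := Cf; have [cg hg] := Cg; split.
  by move=> x; exact: continuousM (cf x) (cg x).
move=> i; have [df Df] := hf i; have [dg Dg] := hg i.
split; first by move=> x; apply: derivableM.
rewrite (_ : 'D_(delta_mx 0 i) _ =
  (f \* 'D_(delta_mx 0 i) g) \+ (g \* 'D_(delta_mx 0 i) f)).
  by apply: C_kD; apply: IH => //; exact: C_kW.
by apply/funext => x; exact: deriveM.
Qed.

Lemma C_k_prod k (I : Type) (s : seq I) (F : I -> 'rV[R]_d -> R) :
  (forall i, C_k k (F i)) -> C_k k (fun x => \prod_(i <- s) F i x).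
Proof.
move=> CF; elim: s => [|i s IH].
  by under eq_fun do rewrite big_nil; exact: C_k_cst.
by under eq_fun do rewrite big_cons; exact: C_kM.
Qed.

Lemma flat_coord_derive k (a b : R) (i j : 'I_d) (x : 'rV[R]_d) :
  is_derive x (delta_mx 0 j) (fun x => flat k (a + b * x ord0 i))
    (b * (i == j)%:R * (flat k.+2 (a + b * x ord0 i) -
      k%:R * flat k.+1 (a + b * x ord0 i))).
Proof.
apply: is_derive_along.
set c := b * (i == j)%:R; set e := a + b * x ord0 i.
rewrite (_ : (fun h => _) = flat k \o (fun h : R => c * h + e)); last first.
  apply/funext => h /=; rewrite !mxE eqxx /= /c /e eq_sym; congr flat; ring.
have H : is_derive (0 : R) (1 : R) (fun h : R => c * h + e) c.
  have [h1 h2] := is_deriveD (is_deriveZ c (@is_derive_id R R 0 1))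
    (@is_derive_cst R R R e 0 1).
  by split => //; apply: etrans h2 _; rewrite addr0 [_%:A]mulr1.
have l0 : c * 0 + e = e by rewrite mulr0 add0r.
have := @is_derive1_comp _ (flat k) (fun h => c * h + e) 0 _ _
  (flat_derive k (c * 0 + e)) H.
by rewrite l0 mulrC.
Qed.

(** Induction on [m] for all [k] at once, since differentiating [flat k] brings in [flat k.+1] and
    [flat k.+2]. *)
Lemma C_k_flat m k (a b : R) (i : 'I_d) :
  C_k m (fun x : 'rV[R]_d => flat k (a + b * x ord0 i)).
Proof.
have cf n : continuous (fun x : 'rV[R]_d => flat n (a + b * x ord0 i)).
  move=> x; apply: (@continuous_comp _ _ _
    (fun x : 'rV[R]_d => a + b * x ord0 i) (flat n)).
    apply: continuousD; first exact: cst_continuous.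
    by apply: continuousM; [exact: cst_continuous|exact: coord_continuous].
  exact: continuous_flat.
elim: m k => [|m IH] k; first exact: cf.
split; first exact: cf.
move=> j; split; first by move=> x; have [] := flat_coord_derive k a b i j x.
rewrite (_ : 'D_(delta_mx 0 j) _ = (fun=> b * (i == j)%:R) \*
  ((fun x => flat k.+2 (a + b * x ord0 i)) \+
   ((fun=> - k%:R) \* (fun x => flat k.+1 (a + b * x ord0 i))))); last first.
  apply/funext => x; have [_ ->] := flat_coord_derive k a b i j x.
  by rewrite /= mulNr.
apply: C_kM; first exact: C_k_cst.
by apply: C_kD => //; apply: C_kM => //; exact: C_k_cst.
Qed.

(** The two factors of index [i] are both positive exactly when [x ord0 i] is within [r] of
    [c ord0 i], so the product is positive exactly on the max-norm ball. The coefficient 1 puts both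
    factors in the form required by [C_k_flat]. *)
Definition bump (c : 'rV[R]_d) (r : R) (x : 'rV[R]_d) : R :=
  \prod_(i < d) (flat 0 (r - c ord0 i + 1 * x ord0 i) *
                 flat 0 (r + c ord0 i + (-1) * x ord0 i)).

Lemma bump_ge0 c r x : 0 <= bump c r x.
Proof. by apply: prodr_ge0 => i _; rewrite mulr_ge0// flat_ge0. Qed.

Lemma bump_le1 c r x : bump c r x <= 1.
Proof.
apply: prodr_ile1 => i _; rewrite mulr_ge0 ?flat_ge0//=.
by rewrite mulr_ile1// ?flat_ge0// flat0_le1.
Qed.

Lemma bump_gt0 c r x : 0 < r -> ball c r x -> 0 < bump c r x.
Proof.
move=> r0 [_ xcr]; apply: prodr_gt0 => i _.
have := xcr ord0 i; rewrite /ball /= ltr_norml => /andP[h1 h2].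
by rewrite mulr_gt0// flat_gt0//; lra.
Qed.

Lemma bump_eq0 c r x : 0 < r -> ~ ball c r x -> bump c r x = 0.
Proof.
move=> r0 xcr; apply/eqP/negPn/negP => /prodf_neq0 h; apply: xcr; split => // i j.
have := h j isT; rewrite (ord1 i) mulf_eq0 negb_or => /andP[h1 h2].
have {}h1 : 0 < r - c ord0 j + 1 * x ord0 j.
  by rewrite ltNge; apply: contra h1 => h1; rewrite flat_le0.
have {}h2 : 0 < r + c ord0 j + (-1) * x ord0 j.
  by rewrite ltNge; apply: contra h2 => h2; rewrite flat_le0.
by rewrite /ball /= ltr_norml; apply/andP; split; lra.
Qed.

Lemma C_k_bump m c r : C_k m (bump c r).
Proof. by apply: C_k_prod => i; apply: C_kM; exact: C_k_flat. Qed.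

Lemma open_rV_rat_ball (V : set 'rV[R]_d) (x : 'rV[R]_d) : open V -> V x ->
  exists p : 'rV[rat]_d * rat, [/\ 0 < ratr p.2 :> R,
    ball (map_mx ratr p.1 : 'rV[R]_d) (ratr p.2) x &
    ball (map_mx ratr p.1 : 'rV[R]_d) (ratr p.2) `<=` V].
Proof.
move=> oV Vx; have := open_rV_bigcup oV => /= VE.
have Vx' := Vx; rewrite VE in Vx'.
case: Vx' => -[c r] [/= r0 cV] cx; exists (c, r) => /=.
have r0' : 0 < ratr r :> R by rewrite ltr0q.
split => //.
  by split => // i j; rewrite (ord1 i) mxE /ball /= distrC; exact: cx.
move=> y [_ cy]; apply: cV => /= i; rewrite distrC.
by have := cy ord0 i; rewrite mxE.
Qed.

(** Heine-Borel: the support lies in the closed ball of radius [M]. *)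
Lemma bounded_support_compact f (M : R) :
  (forall x, M < `|x| -> f x = 0) -> compact (closure [set x | f x != 0]).
Proof.
move=> fM; set A := closure _.
have AM : A `<=` [set x | `|x| <= M].
  have cM : closed [set x : 'rV[R]_d | `|x| <= M].
    rewrite (_ : [set x | _] = (fun x : 'rV[R]_d => `|x|) @^-1` [set y | y <= M]) //.
    apply: closed_comp; last exact: closed_le.
    by move=> x _; exact: norm_continuous.
  rewrite ((closure_id _).1 cM); apply: closureS => x /= fx0.
  by rewrite leNgt; apply: contra fx0 => /fM ->.
apply: bounded_closed_compact; last exact: closed_closure.
exists M; split; first exact: num_real.
by move=> N MN x /AM /= /le_trans; apply; exact: ltW.
Qed.

(* With [h_k] the bumps carried by the rational balls inside [V], the functions
   [1 - \prod_(k < n) (1 - h_k) ^+ n] are smooth because they only involve sums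
   and products: no chain rule is required. *)
Lemma open_rV_smooth_approx (V : set 'rV[R]_d) : open V ->
  exists u : nat -> 'rV[R]_d -> R,
  [/\ forall n, Cc_infty (u n), forall n x, 0 <= u n x <= 1,
    forall n x, ~ V x -> u n x = 0 &
    forall x, V x -> u n x @[n --> \oo] --> (1 : R)].
Proof.
move=> oV.
pose adm (p : 'rV[rat]_d * rat) := 0 < ratr p.2 :> R /\
  ball (map_mx ratr p.1 : 'rV[R]_d) (ratr p.2) `<=` V.
(* The countably many rational balls are enumerated by [unpickle]; an index that codes no ball
   inside [V] contributes the zero function. *)
pose h k (x : 'rV[R]_d) : R := if @unpickle ('rV[rat]_d * rat)%type k is Some p then
  if `[< adm p >] then bump (map_mx ratr p.1) (ratr p.2) x else 0 else 0.
have Ch m k : C_k m (h k).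
  rewrite /h; case: unpickle => [p|]; last exact: C_k_cst.
  by case: asboolP => _; [exact: C_k_bump|exact: C_k_cst].
have h01 k x : 0 <= h k x <= 1.
  rewrite /h; case: unpickle => [p|]; last by rewrite lexx ler01.
  by case: asboolP => _; rewrite ?bump_ge0 ?bump_le1// lexx ler01.
have hV k x : ~ V x -> h k x = 0.
  rewrite /h; case: unpickle => [p|//]; case: asboolP => // -[p0 pV] Vx.
  by rewrite bump_eq0// => /pV.
have Vh x : V x -> exists k, 0 < h k x.
  move=> /(open_rV_rat_ball oV)[p [p0 px pV]]; exists (pickle p).
  by rewrite /h pickleK; case: asboolP => [_|[]//]; exact: bump_gt0.
have hM k : exists M, forall x, M < `|x| -> h k x = 0.
  rewrite /h; case: unpickle => [p|]; last by exists 0.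
  case: asboolP => [[p0 _]|_]; last by exists 0.
  set c : 'rV[R]_d := map_mx ratr p.1.
  exists (ratr p.2 + `|c|) => x xM; apply: bump_eq0 => //.
  rewrite -ball_normE /ball_ /= => cx; move: xM; apply/negP; rewrite -leNgt.
  rewrite (_ : x = c - (c - x)); last by rewrite opprB addrC subrK.
  by rewrite (le_trans (ler_normB _ _))// addrC lerD2r ltW.
pose u n x := 1 - \prod_(k < n) (1 - h k x) ^+ n.
have p01 n x : 0 <= \prod_(k < n) (1 - h k x) ^+ n <= 1.
  have q k : 0 <= (1 - h k x) ^+ n <= 1.
    have /andP[h0 h1] := h01 k x.
    by rewrite exprn_ge0 ?exprn_ile1 ?subr_ge0// lerBlDr lerDl.
  apply/andP; split; first by apply: prodr_ge0 => i _; case/andP: (q i).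
  by apply: prodr_ile1 => i _; exact: q.
exists u; split.
- move=> n; split.
    move=> m; rewrite (_ : u n = (fun=> 1) \+ ((fun=> -1) \*
      (fun x => \prod_(k < n) (\prod_(j < n) ((fun=> 1) \+ ((fun=> -1) \* h k)) x)))).
      apply: C_kD; first exact: C_k_cst.
      apply: C_kM; first exact: C_k_cst.
      apply: C_k_prod => k; apply: C_k_prod => j.
      apply: C_kD; first exact: C_k_cst.
      by apply: C_kM; [exact: C_k_cst|].
    apply/funext => x; rewrite /u /= mulN1r; congr (1 - _).
    by apply: eq_bigr => k _; rewrite prodr_const card_ord mulN1r.
  have /choice[M hM'] := hM.
  (* The function [u n] vanishes where its first [n] bumps do, and the sum of the [|M k|] dominates
     each single radius. *)
  apply: (@bounded_support_compact _ (\sum_(k < n) `|M k|)) => x xM.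
  rewrite /u big1 ?subrr// => k _; rewrite hM' ?subr0 ?expr1n//.
  apply: le_lt_trans xM; rewrite (bigD1 k)//= (le_trans (ler_norm _))// lerDl.
  by apply: sumr_ge0.
- move=> n x; have /andP[p0 p1] := p01 n x.
  by rewrite /u subr_ge0 p1 lerBlDr lerDl.
- move=> n x Vx; rewrite /u big1 ?subrr// => k _.
  by rewrite hV// subr0 expr1n.
(* A single bump positive at [x] suffices: once [n > k], the product is at most [(1 - h k x) ^+ n],
   which tends to 0. *)
- move=> x /Vh[k hk].
  rewrite -[X in _ --> X](subr0 (1 : R)).
  apply: cvgB; first exact: cvg_cst.
  have /andP[h0 h1] := h01 k x.
  have g0 : (1 - h k x) ^+ n @[n --> \oo] --> (0 : R).
    by apply: cvg_expr; rewrite ger0_norm ?subr_ge0// ltrBlDr ltrDl.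
  apply: (@squeeze_cvgr _ _ _ _ (fun=> 0) (fun n => (1 - h k x) ^+ n)) => //;
    last exact: cvg_cst.
  near=> n; have /andP[-> _] /= := p01 n x.
  have kn : (k < n)%N by near: n; exact: nbhs_infty_gt.
  rewrite (bigD1 (Ordinal kn))//= ler_piMr// ?exprn_ge0 ?subr_ge0//.
  apply: prodr_ile1 => i _; have /andP[i0 i1] := h01 i x.
  by rewrite exprn_ge0 ?exprn_ile1 ?subr_ge0// lerBlDr lerDl.
Unshelve. all: by end_near. Qed.

End smooth_bumps.

(** * Regularity of finite Borel measures *)

Section measure_facts.
Context {R : realType}.

Lemma bounded_funP_ex (T : Type) (f : T -> R) :
  bounded_fun f <-> exists M, forall x, `|f x| <= M.
Proof.
split=> [[M [_ h]]|[M h]]; first by exists (M + 1) => x; apply: h; rewrite ?ltrDl.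
exists M; split; first exact: num_real.
by move=> N MN x _; exact: le_trans (h x) (ltW MN).
Qed.

Import HBNNSimple.

(* Needed for [young_conjugate Phi \o g]: a supremum of uncountably many
   functions, for which [ge0_le_integral] would ask for measurability. *)
Lemma ge0_le_integral_nonmeasurable d (T : measurableType d)
    (mu : {measure set T -> \bar R}) (f g : T -> \bar R) :
  (forall x, 0 <= f x)%E -> (forall x, f x <= g x)%E ->
  (\int[mu]_x f x <= \int[mu]_x g x)%E.
Proof.
move=> f0 fg; rewrite !ge0_integralTE//; last by move=> x; exact: le_trans (fg x).
apply: ereal_sup_le => _ [h hf <-]; exists h => // x.
exact: le_trans (fg x).
Qed.

Lemma cvge0_near_le (u : nat -> \bar R) (e : R) : 0 < e ->
  u n @[n --> \oo] --> 0%E -> \forall n \near \oo, (u n <= e%:E)%E.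
Proof.
move=> e0 /fine_cvgP[fu /cvgrPdist_le/(_ _ e0) ue]; near=> n.
have fn : u n \is a fin_num by near: n.
rewrite -(fineK fn) lee_fin; apply: le_trans (ler_norm _) _.
by rewrite -normrN -sub0r; near: n.
Unshelve. all: by end_near. Qed.

(** Passes from filters to sequences, the setting of dominated convergence. *)
Lemma continuous_at_seq (T : pseudoMetricType R) (f : T -> R) (x : T) :
  (forall u : nat -> T, u n @[n --> \oo] --> x -> f (u n) @[n --> \oo] --> f x) ->
  f y @[y --> x] --> f x.
Proof.
move=> fx; apply/cvgrPdist_le => e e0; apply: contrapT => h.
have /choice[u hu] : forall n : nat, exists y, ball x n.+1%:R^-1 y /\ e < `|f x - f y|.
  move=> n; apply: contrapT => hn; apply: h.
  have n0 : 0 < n.+1%:R^-1 :> R by rewrite invr_gt0 ltr0n.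
  apply/nbhs_ballP; exists n.+1%:R^-1 => //= y xy.
  by rewrite leNgt; apply/negP => ey; apply: hn; exists y.
have ux : u n @[n --> \oo] --> x.
  apply/cvg_ballP => d d0; near=> n.
  have [xu _] := hu n; apply: le_ball xu; apply: ltW.
  by near: n; exact: (near_infty_natSinv_lt (PosNum d0)).
have /cvgrPdist_le /(_ _ e0) := fx _ ux => -[N _ /(_ N (leqnn N))] /=.
by have [_] := hu N; rewrite ltNge => /negP.
Unshelve. all: by end_near. Qed.

End measure_facts.

(** * Approximation of Borel sets by closed and open sets *)

Section regularity.
Context {R : realType} {d : nat}.
Notation T := 'rV[R]_d.

Lemma closed_measurable_rV (F : set T) : closed F -> measurable F.
Proof.
by move=> cF; rewrite -[F]setCK; apply: measurableC; apply: open_measurable_rV;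
  exact: closed_openC.
Qed.

Lemma measurable_open_ind (C : set (set T)) :
  (forall U, open U -> C U) -> (forall A, C A -> C (~` A)) ->
  (forall A : nat -> set T, (forall n, C (A n)) -> C (\bigcup_n A n)) ->
  forall A, measurable A -> C A.
Proof.
move=> oC cC uC; apply: smallest_sub => //; split => //; first exact/oC/open0.
by move=> A CA; rewrite setTD; exact: cC.
Qed.

Context (nu : {measure set T -> \bar R}) (nuT : (nu setT < +oo)%E).

Definition closed_open_approx (A : set T) := forall e : R, 0 < e ->
  exists F U, [/\ closed F, open U, F `<=` A, A `<=` U & (nu (U `\` F) <= e%:E)%E].

Let nu_fin (A : set T) : measurable A -> (nu A < +oo)%E.
Proof. by move=> mA; apply: le_lt_trans nuT; apply: le_measure; rewrite ?inE. Qed.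

(** The closed sets [F n], whose points keep their ball of radius [1/(n+1)] inside [U], increase to
    [U]; finiteness of [nu] then makes the measure of [U]\[F n] tend to 0. *)
Lemma open_closed_open_approx (U : set T) : open U -> closed_open_approx U.
Proof.
move=> oU e e0.
pose F n := [set x : T | ball x n.+1%:R^-1 `<=` U].
have cF n : closed (F n).
  rewrite -[F n]setCK; apply: open_closedC.
  rewrite (_ : ~` F n = \bigcup_(y in ~` U) ball y n.+1%:R^-1).
    by apply: bigcup_open => y _; exact: ball_open.
  apply/seteqP; split => [x /= /existsNP[y /not_implyP[xy Uy]]|x [y Uy yx] xU].
    by exists y => //; exact: ball_sym.
  by apply: Uy; apply: xU; exact: ball_sym.
have FU n : F n `<=` U.
  by move=> x; apply; apply: ballxx; rewrite invr_gt0 ltr0n.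
have mU : measurable U by exact: open_measurable_rV.
have mF n : measurable (F n) by exact: closed_measurable_rV.
have cap0 : \bigcap_n (U `\` F n) = set0.
  apply/seteqP; split => // x xUF.
  have [Ux _] := xUF 0%N I.
  have /nbhs_ballP[r /= r0 xrU] : nbhs x U by exact: open_nbhs_nbhs.
  have [n nr] : exists n : nat, n.+1%:R^-1 < r.
    have [N _ /(_ N (leqnn N)) h] := near_infty_natSinv_lt (PosNum r0).
    by exists N.
  have [_] := xUF n I; apply; apply: subset_trans xrU.
  by apply: le_ball; exact: ltW.
have := @nonincreasing_cvg_mu _ _ _ nu (fun n => U `\` F n).
rewrite cap0 measure0 => /(_ _ _ _ _)/wrap[].
- by apply: nu_fin; exact: measurableD.
- by move=> i; exact: measurableD.
- exact: measurable0.
- move=> m n mn; apply/subsetPset; apply: setDS => x Fm y yx; apply: Fm.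
  apply: le_ball yx; rewrite lef_pV2 ?posrE ?ltr0n//.
  by rewrite ler_nat ltnS.
move=> /(cvge0_near_le e0)[N _ /(_ N (leqnn N)) /= hN].
by exists (F N), U; split.
Qed.

Lemma setC_closed_open_approx (A : set T) :
  closed_open_approx A -> closed_open_approx (~` A).
Proof.
move=> cA e e0; have [F [U [cF oU FA AU nuUF]]] := cA e e0.
exists (~` U), (~` F); split.
- exact: open_closedC.
- exact: closed_openC.
- exact: subsetC.
- exact: subsetC.
- by rewrite (_ : ~` F `\` ~` U = U `\` F)// setDE setCK setIC -setDE.
Qed.

(** Half of [e] is shared geometrically among the [A n]. The union of all [F n] need not be closed,
    so it is cut at a finite stage, which costs the other half by continuity from above. *)
Lemma bigcup_closed_open_approx (A : nat -> set T) :
  (forall n, closed_open_approx (A n)) -> closed_open_approx (\bigcup_n A n).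
Proof.
move=> hA e e0.
have e2 : 0 < e / 2 by rewrite divr_gt0.
have en n : 0 < e / 2 / (2 ^ n.+1)%:R by rewrite divr_gt0// ltr0n expn_gt0.
have /choice[F] : forall n, exists F, exists U, [/\ closed F, open U, F `<=` A n,
    A n `<=` U & (nu (U `\` F) <= (e / 2 / (2 ^ n.+1)%:R)%:E)%E].
  by move=> n; exact: hA.
move=> /choice[U hFU].
have oU n : open (U n) by case: (hFU n).
have cF n : closed (F n) by case: (hFU n).
have mU n : measurable (U n) by exact: open_measurable_rV.
have mF n : measurable (F n) by exact: closed_measurable_rV.
pose G n := \big[setU/set0]_(i < n) F i.
have cG n : closed (G n) by apply: closed_bigsetU => i _; exact: cF.
have mG n : measurable (G n) by exact: closed_measurable_rV.
have mbF : measurable (\bigcup_n F n) by exact: bigcupT_measurable.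
have cap0 : \bigcap_n (\bigcup_k F k `\` G n) = set0.
  apply/seteqP; split => // x xUF.
  have [[k _ Fk] _] := xUF 0%N I.
  have [_] := xUF k.+1 I; apply; rewrite /G big_ord_recr /=.
  by right.
have := @nonincreasing_cvg_mu _ _ _ nu (fun n => \bigcup_k F k `\` G n).
rewrite cap0 measure0 => /(_ _ _ _ _)/wrap[].
- by apply: nu_fin; exact: measurableD.
- by move=> i; exact: measurableD.
- exact: measurable0.
- move=> m n mn; apply/subsetPset; apply: setDS.
  exact: subset_bigsetU.
move=> /(cvge0_near_le e2)[N _ /(_ N (leqnn N)) /= hN].
exists (G N), (\bigcup_n U n); split => //.
- by apply: bigcup_open => n _.
- rewrite /G => x; rewrite -bigcup_mkord => -[k _ Fk]; exists k => //.
  by have [_ _ FA _ _] := hFU k; exact: FA.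
- move=> x [k _ Ak]; exists k => //.
  by have [_ _ _ AU _] := hFU k; exact: AU.
have sub : \bigcup_n U n `\` G N `<=`
    (\bigcup_n (U n `\` F n)) `|` (\bigcup_k F k `\` G N).
  move=> x [[k _ Uk] Gx]; have [Fk|Fk] := pselect (F k x).
    by right; split => //; exists k.
  by left; exists k.
have mUF : measurable (\bigcup_n (U n `\` F n)).
  by apply: bigcupT_measurable => n; exact: measurableD.
have mKG : measurable (\bigcup_k F k `\` G N) by exact: measurableD.
apply: le_trans (le_measure _ _ _ sub) _; rewrite ?inE.
- by apply: measurableD => //; exact: bigcupT_measurable.
- exact: measurableU.
apply: le_trans (measureU2 _ _ _) _ => //.
rewrite [e in leRHS]splitr EFinD leeD//.
apply: (@le_trans _ _ (\sum_(n <oo) nu (U n `\` F n))%E).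
  apply: measure_sigma_subadditive => //.
  by move=> n; exact: measurableD.
apply: (@le_trans _ _ (\sum_(n <oo) (e / 2 / (2 ^ n.+1)%:R)%:E)%E).
  by apply: lee_nneseries => // n _; case: (hFU n).
exact: epsilon_trick0 (ltW e2).
Qed.

Lemma measurable_closed_open_approx (A : set T) :
  measurable A -> closed_open_approx A.
Proof.
apply: measurable_open_ind A.
- exact: open_closed_open_approx.
- exact: setC_closed_open_approx.
- exact: bigcup_closed_open_approx.
Qed.

End regularity.

(** * Convolution with a probability measure *)

(** The [e / 3] argument. Both [G] and the neighbourhood may depend on [e]; this locality is used in
    [continuous_convol_indic], where the estimate holds only near [x]. *)
Lemma continuous_approx (R : realType) (T : pseudoMetricType R) (F : T -> R) (x : T) :
  (forall e, 0 < e -> exists G : T -> R, {for x, continuous G} /\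
    \forall y \near x, `|F y - G y| <= e) -> {for x, continuous F}.
Proof.
move=> h; apply/cvgrPdist_le => e e0.
have e3 : 0 < e / 3 by rewrite divr_gt0.
have [G [/cvgrPdist_le /(_ _ e3) cG FG]] := h _ e3.
near=> y.
have Fx : `|F x - G x| <= e / 3 by exact: nbhs_singleton FG.
have Fy : `|F y - G y| <= e / 3 by near: y.
have Gxy : `|G x - G y| <= e / 3 by near: y.
rewrite (_ : F x - F y = (F x - G x) + (G x - G y) - (F y - G y)); last by ring.
rewrite (le_trans (ler_normB _ _))// (le_trans (lerD (ler_normD _ _) (lexx _)))//.
rewrite (_ : e = e / 3 + e / 3 + e / 3); last by field.
by rewrite !lerD.
Unshelve. all: by end_near. Qed.

Section convolution.
Context {R : realType} {d : nat}.
Notation T := 'rV[R]_d.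
Variable mu : probability 'rV[R]_d R.
Implicit Types (f g : T -> R) (x : T).

Definition convol f x : R := \int[mu]_y f (x + y).

Lemma measurable_translate x : measurable_fun setT (fun y : T => x + y).
Proof. by under eq_fun do rewrite addrC; exact: measurable_shift_rV. Qed.

Lemma measurable_translate_set x (A : set T) : measurable A ->
  measurable [set y | A (x + y)].
Proof.
by move=> mA; rewrite -[X in measurable X]setTI; exact: measurable_translate.
Qed.

Lemma measurable_continuous f : continuous f -> measurable_fun setT f.
Proof.
move=> cf; apply: (measurability _ (measurable_realfun.RGenOpens.measurableE R)).
move=> _ [_ [a [b ->]] <-]; rewrite setTI.
apply: open_measurable_rV; apply: open_comp; last exact: interval_open.
by move=> v _; exact: cf.
Qed.

Lemma measurable_comp_translate f x : measurable_fun setT f ->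
  measurable_fun setT (fun y => f (x + y)).
Proof. by move=> mf; apply: measurableT_comp => //; exact: measurable_translate. Qed.

Lemma integrable_bounded (h : T -> R) M : measurable_fun setT h ->
  (forall x, `|h x| <= M) -> mu.-integrable setT (EFin \o h).
Proof.
move=> mh hM; apply: measurable_bounded_integrable => //.
- exact: fin_num_fun_lty.
- by apply/bounded_funP_ex; exists M.
Qed.

Lemma Rintegral_prob_le (h : T -> R) M : measurable_fun setT h ->
  (forall x, 0 <= h x <= M) -> \int[mu]_y h y <= M.
Proof.
move=> mh hM; have h0 x : 0 <= h x by case/andP: (hM x).
have <- : \int[mu]_y M = M.
  by rewrite Rintegral_cst// [X in fine X](probability_setT mu) mulr1.
apply: le_Rintegral => //.
- by apply: (@integrable_bounded _ M) => // x; rewrite ger0_norm//; case/andP: (hM x).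
- exact: (@integrable_bounded _ `|M|).
- by move=> x _; case/andP: (hM x).
Qed.

(** The pointwise bound [k] stays under the integral so that it can be a sum of indicators; a
    constant [k] gives [convol_dist_unif]. *)
Lemma convol_dist f g x (k : T -> R) M N : measurable_fun setT f ->
  measurable_fun setT g -> measurable_fun setT k ->
  (forall z, `|f z| <= M) -> (forall z, `|g z| <= M) -> (forall z, `|k z| <= N) ->
  (forall y, `|f (x + y) - g (x + y)| <= k y) ->
  `|convol f x - convol g x| <= \int[mu]_y k y.
Proof.
move=> mf mg mk fM gM kN fgk.
have mf' := measurable_comp_translate x mf.
have mg' := measurable_comp_translate x mg.
have If : mu.-integrable setT (EFin \o (fun y => f (x + y))).
  by apply: (@integrable_bounded _ M).
have Ig : mu.-integrable setT (EFin \o (fun y => g (x + y))).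
  by apply: (@integrable_bounded _ M).
rewrite /convol -RintegralB//.
have fgM z : `|f (x + z) - g (x + z)| <= M + M.
  by rewrite (le_trans (ler_normB _ _))// lerD.
have mfg : measurable_fun setT (fun y => f (x + y) - g (x + y)).
  exact: measurable_funB.
have Ifg : mu.-integrable setT (EFin \o (fun y => f (x + y) - g (x + y))).
  exact: (@integrable_bounded _ (M + M)).
apply: le_trans (le_normr_Rintegral _ _) _ => //.
apply: le_Rintegral => //; last exact: (@integrable_bounded _ N).
apply: (@integrable_bounded _ (M + M)) => [|z]; last by rewrite normr_id.
exact: measurableT_comp.
Qed.

Lemma convol_dist_unif f g M e x : measurable_fun setT f ->
  measurable_fun setT g ->
  (forall z, `|f z| <= M) -> (forall z, `|g z| <= M) ->
  (forall z, `|f z - g z| <= e) -> `|convol f x - convol g x| <= e.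
Proof.
move=> mf mg fM gM fge.
apply: le_trans (@convol_dist f g x (fun=> e) M `|e| _ _ _ _ _ _ _) _ => //.
apply: Rintegral_prob_le => // _; rewrite lexx andbT.
exact: le_trans (fge 0).
Qed.

Lemma convol_bounded f M : measurable_fun setT f -> (forall z, `|f z| <= M) ->
  forall x, `|convol f x| <= M.
Proof.
move=> mf fM x.
have M0 : 0 <= M by exact: le_trans (fM 0).
have := @convol_dist_unif f (fun=> 0) M M x mf _ fM _ _.
rewrite {2}/convol Rintegral_cst// mul0r subr0; apply => //.
- by move=> z; rewrite normr0.
- by move=> z; rewrite subr0.
Qed.

(** Dominated convergence along sequences, with the constant [M] as dominating function. *)
Lemma continuous_convol f M : continuous f -> (forall z, `|f z| <= M) ->
  continuous (convol f).
Proof.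
move=> cf fM x; apply: continuous_at_seq => u ux.
have mf := measurable_continuous cf.
have [| | | | |_ _ h] := @dominated_convergence _ _ _ mu setT measurableT
  (fun n y => (f (u n + y))%:E) (fun y => (f (x + y))%:E) (fun=> M%:E).
- by move=> n; apply/measurable_EFinP; exact: measurable_comp_translate.
- by apply/measurable_EFinP; exact: measurable_comp_translate.
- apply: aeW => y _; apply: cvg_EFin; first by apply: nearW.
  have : u n + y @[n --> \oo] --> x + y by apply: cvgD => //; exact: cvg_cst.
  by move=> /(cvg_comp _ _); apply; exact: cf.
- exact: (@integrable_bounded (fun=> M) `|M|).
- by apply: aeW => y n _; rewrite /= lee_fin.
- apply: fine_cvg; move: h.
  have <- : (convol f x)%:E = (\int[mu]_y (f (x + y))%:E)%E; last by [].
  rewrite fineK//; apply: integrable_fin_num => //.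
  apply: (@integrable_bounded (fun y => f (x + y)) M) => //.
  exact: measurable_comp_translate.
Qed.

Lemma Rintegral_indic_fine (A : set T) : measurable A ->
  \int[mu]_y \1_A y = fine (mu A).
Proof. by move=> mA; rewrite /Rintegral integral_indic// setIT. Qed.

Lemma ball_tight e : 0 < e -> exists2 M : R, 0 < M &
  fine (mu (~` ball (0 : T) M)) <= e.
Proof.
move=> e0.
have mB n : measurable (ball (0 : T) n.+1%:R) by exact: measurable_ball_rV.
have := @nonincreasing_cvg_mu _ _ _ mu (fun n => ~` ball (0 : T) n.+1%:R).
rewrite -setC_bigcup bigcup_ball_rV setCT measure0 => /(_ _ _ _ _)/wrap[].
- apply: le_lt_trans (probability_le1 mu _) _; last exact: ltry.
  exact: measurableC.
- by move=> n; exact: measurableC.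
- exact: measurable0.
- move=> m n mn; apply/subsetPset; apply: subsetC; apply: le_ball.
  by rewrite ler_nat.
move=> /(cvge0_near_le e0)[N _ /(_ N (leqnn N)) /= hN].
exists N.+1%:R => //; rewrite -lee_fin fineK// fin_num_measure//.
exact: measurableC.
Qed.

(* Restricting to open [E] loses nothing: it is applied to [U `\` F] with [F]
   closed and [U] open around a given Borel set. *)
Definition unif_dominated := forall e : R, 0 < e -> exists2 r : R, 0 < r &
  forall (E : set T) x, open E -> (lebesgue_rV E <= r%:E)%E ->
    fine (mu [set y | E (x + y)]) <= e.

(** Near [x], [convol \1_A] is uniformly close to [convol g] with [g] continuous: tightness handles
    large [y], and domination handles the small set where [g] and [\1_A] differ. *)
Lemma continuous_convol_indic (A : set T) : unif_dominated -> measurable A ->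
  continuous (convol \1_A).
Proof.
move=> domu mA x; apply: continuous_approx => e e0.
have e2 : 0 < e / 2 by rewrite divr_gt0.
have [r r0 hr] := domu _ e2.
have [M M0 hM] := ball_tight e2.
(* [Q] contains [z + y] whenever [z] is within 1 of [x] and [y] within [M] of 0. Lebesgue measure
   restricted to it is finite, as regularity demands. *)
set Q := ball x (M + 1).
have M1 : 0 < M + 1 by rewrite addr_gt0.
have mQ : measurable Q by exact: measurable_ball_rV.
have nuT : (mrestr (@lebesgue_rV R d) mQ setT < +oo)%E.
  by rewrite /mrestr setTI lebesgue_rV_ball// ltry.
have [F [U [cF oU FA AU nuUF]]] := measurable_closed_open_approx nuT mA r0.
(* Urysohn: [g] is 1 on [F] and 0 off [U], so it differs from [\1_A] by at most [\1_(U]\[F)]. *)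
have /(@uniform_separatorP T R)[g [cg g01 gU gF]] : uniform_separator (~` U) F.
  have /(@normal_separatorP R T) ns := @pseudometric_normal R T.
  apply: ns => //; first exact: open_closedC.
  by apply/seteqP; split => // z [Uz Fz]; apply: Uz; exact/AU/FA.
have {}g01 z : 0 <= g z <= 1.
  by have := g01 (g z); rewrite /= in_itv/=; apply; exists z.
have gU0 z : ~ U z -> g z = 0 by move=> Uz; apply: gU; exists z.
have gF1 z : F z -> g z = 1 by move=> Fz; apply: gF; exists z.
have g1 z : `|g z| <= 1 by have /andP[g0 ?] := g01 z; rewrite ger0_norm.
pose E := (U `\` F) `&` Q.
have oE : open E.
  by apply: openI; [apply: openI => //; exact: closed_openC|exact: ball_open].
have mE : measurable E by exact: open_measurable_rV.
have mB : measurable (~` ball (0 : T) M).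
  by apply: measurableC; exact: measurable_ball_rV.
exists (convol g); split; first exact: continuous_convol cg g1 _.
near=> z.
have xz : ball x 1 z by near: z; exact: nbhsx_ballx.
have i1 (B : set T) t : `|\1_B t| <= 1 :> R.
  by rewrite indicE; case: (_ \in _); rewrite ?normr1// normr0 ler01.
have mEz : measurable [set y | E (z + y)] by exact: measurable_translate_set.
(* Outside the ball of radius [M] the error is bounded by 1; inside it, [z + y] lies in [Q] and the
   indicator of [E] suffices. Each term integrates to at most [e / 2]. *)
apply: (@le_trans _ _ (\int[mu]_y (\1_[set y | E (z + y)] y + \1_(~` ball (0 : T) M) y))).
  apply: (@convol_dist \1_A g z _ 1 (1 + 1)) => //.
  - exact: measurable_continuous.
  - exact: measurable_funD.
  - by move=> t; rewrite (le_trans (ler_normD _ _))// lerD.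
  move=> y; set t := z + y.
  have AFU : `|\1_A t - g t| <= \1_(U `\` F) t.
    rewrite !indicE in_setD; have [Ft|Ft] := pselect (F t).
      by rewrite gF1// (mem_set (FA _ Ft)) subrr normr0.
    rewrite (memNset Ft)/=; have [Ut|Ut] := pselect (U t).
      rewrite (mem_set Ut)/=; have /andP[g0 g1'] := g01 t.
      by case: (_ \in _); rewrite /= ?(mulr1n, mulr0n) ler_norml; apply/andP; split; lra.
    rewrite (memNset Ut) memNset; last by move/AU.
    by rewrite gU0// subrr normr0.
  have [By|By] := pselect (ball (0 : T) M y); last first.
    rewrite [X in _ <= _ + X]indicE mem_set//= (le_trans AFU)//.
    apply: (@le_trans _ _ 1); last by rewrite lerDr indicE.
    by rewrite indicE; case: (_ \in _).
  rewrite (le_trans AFU)// (@le_trans _ _ (\1_[set y | E (z + y)] y))// ?lerDl//.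
  rewrite !indicE; have [UFt|UFt] := pselect ((U `\` F) t); last by rewrite memNset.
  rewrite (mem_set UFt) mem_set//=; split => //; rewrite /Q -/t.
  rewrite addrC; apply: ball_triangle xz _.
  by move: By; rewrite -!ball_normE /ball_ /= /t sub0r opprD addrA subrr sub0r.
rewrite RintegralD//; last 2 first.
- exact: (@integrable_bounded _ 1).
- exact: (@integrable_bounded _ 1).
rewrite !Rintegral_indic_fine// [leRHS]splitr lerD//.
by apply: hr.
Unshelve. all: by end_near. Qed.

(** The sum is the minimum of [n] and the integer part of [y]. The first clause feeds the induction
    when [n <= y < n + 1]. *)
Lemma sum_floor_indic n (y : R) : 0 <= y ->
  (n%:R <= y -> \sum_(k < n) (k.+1%:R <= y)%R%:R = n%:R :> R) /\
  (y < n%:R -> \sum_(k < n) (k.+1%:R <= y)%R%:R <= y /\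
     y <= \sum_(k < n) (k.+1%:R <= y)%R%:R + 1 :> R).
Proof.
move=> y0; elim: n => [|n [IH1 IH2]].
  by rewrite big_ord0; split=> // y0'; move: (lt_le_trans y0' y0); rewrite ltxx.
rewrite big_ord_recr /=; split.
  move=> ny; rewrite ny IH1; last by rewrite (le_trans _ ny)// ler_nat.
  by rewrite natr1.
move=> yn; have -> : (n.+1%:R <= y) = false by rewrite leNgt yn.
rewrite addr0; have [yn'|/IH2//] := leP n%:R y.
by rewrite IH1// natr1 yn'; split => //; exact: ltW.
Qed.

Lemma continuous_convol_sum (I : Type) (s : seq I) (F : I -> T -> R) M x :
  (forall i, measurable_fun setT (F i)) -> (forall i z, `|F i z| <= M) ->
  (forall i, {for x, continuous (convol (F i))}) ->
  {for x, continuous (convol (fun z => \sum_(i <- s) F i z))}.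
Proof.
move=> mF FM cF.
(* Integrability is carried along the induction because additivity of the integral asks for it. *)
suff [h _] : convol (fun z => \sum_(i <- s) F i z) =
    (fun z => \sum_(i <- s) convol (F i) z) /\
    forall z, mu.-integrable setT (EFin \o (fun y => \sum_(i <- s) F i (z + y))).
  rewrite h; elim: s {h} => [|i s IH].
    rewrite (_ : (fun z => _) = fun=> 0); first exact: cst_continuous.
    by apply/funext => z; rewrite big_nil.
  rewrite (_ : (fun z => _) = convol (F i) \+ (fun z => \sum_(j <- s) convol (F j) z)).
    exact: continuousD.
  by apply/funext => z; rewrite big_cons.
have IF i z : mu.-integrable setT (EFin \o (fun y => F i (z + y))).
  by apply: (@integrable_bounded _ M) => //; exact: measurable_comp_translate.
elim: s => [|i s [IH1 IH2]].
  split=> [|z].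
    apply/funext => z; rewrite big_nil /convol.
    by under eq_Rintegral do rewrite big_nil; rewrite Rintegral_cst// mul0r.
  rewrite (_ : EFin \o _ = EFin \o (fun=> 0)).
    by apply: (@integrable_bounded (fun=> 0) 0) => // y; rewrite normr0.
  by apply/funext => y; rewrite /= big_nil.
have bE z : EFin \o (fun y => \sum_(j <- i :: s) F j (z + y)) =
    (EFin \o (fun y => F i (z + y))) \+ (EFin \o (fun y => \sum_(j <- s) F j (z + y))).
  by apply/funext => y; rewrite /= big_cons EFinD.
split=> [|z]; last by rewrite bE; exact: integrableD.
apply/funext => z; rewrite big_cons -(congr1 (fun h => h z) IH1) /convol -RintegralD//.
by apply: eq_Rintegral => y _; rewrite big_cons.
Qed.

Lemma continuous_convol_affine f a b M x : measurable_fun setT f ->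
  (forall z, `|f z| <= M) -> {for x, continuous (convol f)} ->
  {for x, continuous (convol (fun z => a + b * f z))}.
Proof.
move=> mf fM cf.
have If z : mu.-integrable setT (EFin \o (fun y => f (z + y))).
  by apply: (@integrable_bounded _ M) => //; exact: measurable_comp_translate.
rewrite (_ : convol _ = fun z => a + b * convol f z).
  apply: continuousD; first exact: cst_continuous.
  by apply: continuousM => //; exact: cst_continuous.
apply/funext => z; rewrite /convol RintegralD//; last 2 first.
- exact: (@integrable_bounded (fun=> a) `|a|).
- apply: (@integrable_bounded _ (`|b| * M)).
    by apply: measurable_funM => //; exact: measurable_comp_translate.
  by move=> y; rewrite normrM ler_pM.
rewrite RintegralZl// Rintegral_cst// [X in fine X](probability_setT mu) mulr1.
by [].
Qed.

(** Rescale [f] to take values in [[0, n + 1)], replace it by its integer part, which is a sum of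
    indicators of level sets, and scale back. *)
Lemma continuous_convol_measurable f M : unif_dominated ->
  measurable_fun setT f -> (forall z, `|f z| <= M) -> continuous (convol f).
Proof.
move=> domu mf fM x; apply: continuous_approx => e e0.
have M0 : 0 <= M by exact: le_trans (fM 0).
have [n hn] : exists n : nat, (M *+ 2 + 1) / e < n.+1%:R.
  exists (Num.truncn ((M *+ 2 + 1) / e)); exact: truncnS_gt.
have ne : (M *+ 2 + 1) / n.+1%:R <= e.
  by rewrite ler_pdivrMr// mulrC -ler_pdivrMr// ltW.
(* The summand 1 makes [c] positive even for [M = 0], and keeps [h] strictly below [n.+1]. *)
set c := (M *+ 2 + 1).
have c0 : 0 < c by rewrite ltr_wpDl// mulrn_wge0.
pose h z := n.+1%:R / c * (f z + M).
have h0 z : 0 <= h z.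
  apply: mulr_ge0; first by rewrite divr_ge0// ltW.
  by have := fM z; rewrite ler_norml => /andP[f1 f2]; lra.
have hlt z : h z < n.+1%:R.
  rewrite /h -mulrA gtr_pMr// mulrC ltr_pdivrMr// mul1r /c.
  by have := fM z; rewrite ler_norml mulr2n => /andP[f1 f2]; lra.
have mh : measurable_fun setT h.
  by apply: measurable_funM => //; exact: measurable_funD.
pose A k := [set z | k.+1%:R <= h z].
have mA k : measurable (A k).
  rewrite (_ : A k = h @^-1` `[k.+1%:R, +oo[%classic).
    by rewrite -[X in measurable X]setTI; apply: mh => //; exact: measurable_itv.
  by apply/seteqP; split => z; rewrite /A /= in_itv/= andbT.
(* [S] is the integer part of [h], hence within 1 of it; scaling back turns this into an error of at
   most [c / n.+1%:R <= e]. *)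
pose S z : R := \sum_(k <- iota 0 n.+1) \1_(A k) z.
have SE z : S z = \sum_(k < n.+1) (k.+1%:R <= h z)%R%:R.
  rewrite /S -[iota 0 n.+1]/(index_iota 0 n.+1) big_mkord.
  by apply: eq_bigr => k _; rewrite indicE; congr (nat_of_bool _)%:R;
    apply/idP/idP; rewrite inE.
have i1 (B : set T) t : `|\1_B t| <= 1 :> R.
  by rewrite indicE; case: (_ \in _); rewrite ?normr1// normr0 ler01.
have mS : measurable_fun setT S.
  by apply: measurable_sum => k; exact: measurable_indic.
have S0 z : 0 <= S z <= n.+1%:R.
  rewrite SE; apply/andP; split; first exact: sumr_ge0.
  rewrite (le_trans (ler_sum _ (G := fun=> 1) _))//; last by rewrite sumr_const card_ord.
  by move=> k _; case: (_ <= h z).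
pose g z := - M + c / n.+1%:R * S z.
have fg z : `|f z - g z| <= e.
  apply: le_trans ne; have [_ /(_ (hlt z))] := sum_floor_indic n.+1 (h0 z).
  rewrite -SE => -[h1 h2].
  have n0 : n.+1%:R != 0 :> R by rewrite pnatr_eq0.
  have fE : f z = - M + c / n.+1%:R * h z.
    have aux (a b s N : R) : s != 0 -> N != 0 -> a = - b + s / N * (N / s * (a + b)).
      by move=> s0 N0; field; rewrite s0 N0.
    by apply: aux => //; rewrite gt_eqF.
  rewrite fE /g (_ : _ - _ = c / n.+1%:R * (h z - S z)); last by ring.
  have cn0 : 0 <= c / n.+1%:R by rewrite divr_ge0// ltW.
  rewrite normrM (ger0_norm cn0) ler_piMr//.
  by rewrite ler_norml; apply/andP; split; lra.
have SM z : `|S z| <= n.+1%:R.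
  by have /andP[s0 s1] := S0 z; rewrite ger0_norm.
have mg : measurable_fun setT g.
  by apply: measurable_funD => //; exact: measurable_funM.
exists (convol g); split.
  apply: (@continuous_convol_affine S (- M) (c / n.+1%:R) n.+1%:R) => //.
  apply: (@continuous_convol_sum _ _ _ 1) => // k.
    exact: measurable_indic.
  exact: continuous_convol_indic.
near=> y; apply: (@convol_dist_unif f g (M + e)) => //.
- by move=> z; rewrite (le_trans (fM z))// lerDl ltW.
- move=> z; rewrite (_ : g z = f z - (f z - g z)); last by rewrite opprB addrC subrK.
  by rewrite (le_trans (ler_normB _ _))// lerD.
Unshelve. all: by end_near. Qed.

End convolution.

(** * Orlicz bounds imply uniform domination *)

Section orlicz.
Context {R : realType} {d : nat}.
Notation T := 'rV[R]_d.
Variable Phi : R -> R.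
Hypothesis (Phi0 : Phi 0 = 0) (Phi_ge0 : forall x, 0 <= Phi x).

Lemma young_conjugate_ge (a y : R) : 0 <= a ->
  ((a * `|y| - Phi a)%:E <= young_conjugate Phi y)%E.
Proof. by move=> a0; apply: ereal_sup_ubound; exists a. Qed.

Lemma young_conjugate_ge0 (y : R) : (0 <= young_conjugate Phi y)%E.
Proof. by have := young_conjugate_ge y (lexx 0); rewrite mul0r Phi0 subrr. Qed.

Lemma young_conjugate_at0 : young_conjugate Phi 0 = 0%E.
Proof.
apply/eqP; rewrite eq_le young_conjugate_ge0 andbT.
by apply: ge_ereal_sup => _ [x _ <-]; rewrite normr0 mulr0 sub0r lee_fin oppr_le0.
Qed.

Lemma orlicz_norm_ge0 (u : T -> R) : (0 <= orlicz_norm Phi u)%E.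
Proof.
apply: le_ereal_sup_tmp; exists (\int[@lebesgue_rV R d]_x `|u x * 0|%:E)%E; last first.
  by apply: integral_ge0 => x _; rewrite lee_fin.
exists (fun=> 0) => //; split => //.
by under eq_integral do rewrite young_conjugate_at0; rewrite integral0 lee01.
Qed.

(* Young's inequality [a |g| <= Phi a + young_conjugate Phi g], in which
   [young_conjugate Phi g] is replaced by the measurable minorant
   [k = (a |g| - Phi a)^+]. *)
Lemma orlicz_norm_le_indic (u : T -> R) (V : set T) (a : R) : 0 < a ->
  measurable V -> measurable_fun setT u ->
  (forall x, 0 <= u x <= 1) -> (forall x, ~ V x -> u x = 0) ->
  (orlicz_norm Phi u <= a^-1%:E * ((Phi a)%:E * lebesgue_rV V + 1))%E.
Proof.
move=> a0 mV mu u01 uV; apply: ge_ereal_sup => _ [g [mg g1] <-].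
pose k x := Num.max (a * `|g x| - Phi a) 0.
have k0 x : 0 <= k x by rewrite le_max lexx orbT.
have mk : measurable_fun setT k.
  apply: measurable_maxr => //; apply: measurable_funB => //.
  by apply: measurable_funM => //; exact: measurableT_comp.
have mF : measurable_fun setT (fun x => Phi a * \1_V x + k x).
  apply: measurable_funD; last exact: mk.
  apply: measurable_funM; first exact: measurable_cst.
  exact: measurable_indic mV.
apply: (@le_trans _ _ (\int[@lebesgue_rV R d]_x
    (a^-1 * (Phi a * \1_V x + k x))%:E)%E).
  apply: ge0_le_integral_nonmeasurable => x; rewrite lee_fin//.
  rewrite indicE; have [Vx|Vx] := pselect (V x); last first.
    by rewrite uV// mul0r normr0 memNset// mulr0 add0r mulr_ge0// invr_ge0 ltW.
  rewrite mem_set// mulr1 -ler_pdivrMl ?invr_gt0// invrK.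
  have /andP[u0 u1] := u01 x.
  apply: (@le_trans _ _ (a * `|g x|)).
    by rewrite ler_pM2l// normrM (ger0_norm u0) ler_piMl.
  by rewrite -lerBlDl /k le_max lexx.
under eq_integral do rewrite EFinM.
rewrite ge0_integralZl//; last 3 first.
- exact/measurable_EFinP.
- by move=> x _; rewrite lee_fin addr_ge0// mulr_ge0.
- by rewrite lee_fin invr_ge0 ltW.
apply: lee_wpmul2l; first by rewrite lee_fin invr_ge0 ltW.
under eq_integral do rewrite EFinD.
rewrite ge0_integralD//; last 4 first.
- by move=> x _; rewrite lee_fin mulr_ge0.
- apply/measurable_EFinP; apply: measurable_funM => //; exact: measurable_indic.
- by move=> x _; rewrite lee_fin.
- exact/measurable_EFinP.
apply: leeD.
  under eq_integral do rewrite EFinM.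
  rewrite ge0_integralZl//; last 2 first.
  - by apply/measurable_EFinP; exact: measurable_indic.
  - by rewrite lee_fin.
  by rewrite integral_indic// setIT.
apply: le_trans g1; apply: ge0_le_integral_nonmeasurable => x; rewrite ?lee_fin//.
rewrite /k /Num.max; case: ifPn => _; first exact: young_conjugate_ge0.
exact: young_conjugate_ge (ltW a0).
Qed.

Variables (mu : probability T R) (C : R).
Hypothesis muC : forall u : T -> R, Cc_infty u ->
  (sup_norm (convol mu u) <= C%:E * orlicz_norm Phi u)%E.

(** The hypothesis on smooth functions passes to the indicator of [V] by dominated convergence, the
    Orlicz norms being bounded uniformly in [n]. The sign of [C] is unknown, hence [|C|]. *)
Lemma open_le_orlicz (V : set T) (x : T) (a : R) : 0 < a -> open V ->
  (mu [set y | V (x + y)%R] <=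
    `|C|%R%:E * (a^-1%:E * ((Phi a)%:E * lebesgue_rV V + 1)))%E.
Proof.
move=> a0 oV; have [u [Cu u01 u0 u1]] := open_rV_smooth_approx oV.
have mV : measurable V by exact: open_measurable_rV.
have mu_ n : measurable_fun setT (u n).
  by apply: measurable_continuous; case: (Cu n) => /(_ 0%N).
have un1 n z : `|u n z| <= 1 by have /andP[h0 h1] := u01 n z; rewrite ger0_norm.
have mVx := measurable_translate_set x mV.
have [| | | | |_ _ h] := @dominated_convergence _ _ _ mu setT measurableT
  (fun n y => (u n (x + y))%:E) (fun y => (\1_[set y | V (x + y)] y)%:E) (fun=> 1%:E).
- by move=> n; apply/measurable_EFinP; exact: measurable_comp_translate.
- by apply/measurable_EFinP; exact: measurable_indic.
- apply: aeW => y _; apply: cvg_EFin; first by apply: nearW.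
  rewrite indicE; have [Vy|Vy] := pselect (V (x + y)).
    by rewrite mem_set//; exact: u1.
  rewrite memNset//; under eq_fun do rewrite /= u0//; exact: cvg_cst.
- exact: (@integrable_bounded _ _ _ (fun=> 1) `|1|).
- by apply: aeW => y n _; rewrite /= lee_fin.
rewrite integral_indic// setIT in h.
apply: (cvge_to_le h); apply: nearW => n /=.
have -> : (\int[mu]_y (u n (x + y)%R)%:E)%E = (convol mu (u n) x)%:E.
  rewrite /convol /Rintegral fineK//; apply: integrable_fin_num => //.
  apply: (@integrable_bounded _ _ _ (fun y => u n (x + y)) 1) => //.
  exact: measurable_comp_translate.
apply: (@le_trans _ _ `|convol mu (u n) x|%:E); first by rewrite lee_fin ler_norm.
apply: (@le_trans _ _ (sup_norm (convol mu (u n)))).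
  by apply: ereal_sup_ubound; exists x.
apply: le_trans (muC (Cu n)) _.
apply: (@le_trans _ _ (`|C|%R%:E * orlicz_norm Phi (u n))%E).
  by apply: lee_wpmul2r; [exact: orlicz_norm_ge0|rewrite lee_fin ler_norm].
apply: lee_wpmul2l; first by rewrite lee_fin.
exact: (orlicz_norm_le_indic a0 mV (mu_ n) (u01 n) (u0 n)).
Qed.

Lemma unif_dominated_orlicz : unif_dominated mu.
Proof.
(* This [a] gives [2 * |C| / a <= e], and the radius [(Phi a + 1)^-1] below gives
   [Phi a * |E| <= 1]; the added 1s ensure positivity. *)
move=> e e0; set a := 2 * (`|C| + 1) / e.
have a0 : 0 < a by rewrite divr_gt0// mulr_gt0// ltr_wpDl.
have P1 : 0 < Phi a + 1 by rewrite ltr_wpDl.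
exists (Phi a + 1)^-1; first by rewrite invr_gt0.
move=> E x oE Er; rewrite -lee_fin fineK; last first.
  apply: fin_num_measure; apply: measurable_translate_set.
  exact: open_measurable_rV.
apply: le_trans (open_le_orlicz x a0 oE) _.
apply: (@le_trans _ _ (`|C|%R%:E * (a^-1%:E * ((Phi a)%:E * (Phi a + 1)^-1%:E + 1)))%E).
  apply: lee_wpmul2l; first by rewrite lee_fin.
  apply: lee_wpmul2l; first by rewrite lee_fin invr_ge0 ltW.
  by rewrite leeD2r// lee_wpmul2l// lee_fin.
have -> : (a^-1%:E * ((Phi a)%:E * (Phi a + 1)^-1%:E + 1) =
    (a^-1 * (Phi a / (Phi a + 1) + 1))%:E)%E by [].
rewrite -EFinM lee_fin.
have h : Phi a / (Phi a + 1) <= 1 by rewrite ler_pdivrMr// mul1r lerDl.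
apply: (@le_trans _ _ (`|C| * (a^-1 * 2))).
  by rewrite ler_wpM2l// ler_pM2l ?invr_gt0//; lra.
have ea : e * a = 2 * (`|C| + 1) by rewrite /a mulrC divfK// gt_eqF.
rewrite (_ : _ * _ = `|C| * 2 / a); last by ring.
by rewrite ler_pdivrMr// ea; lra.
Qed.

End orlicz.

(** * The strong Feller property implies an Orlicz bound *)

Lemma indic_preimage (R : realType) (T U : Type) (A : set U) (f : T -> U) (x : T) :
  \1_A (f x) = \1_(f @^-1` A) x :> R.
Proof.
by rewrite !indicE; have [Ax|Ax] := pselect (A (f x));
  [rewrite !mem_set|rewrite !memNset].
Qed.

(** * Absolute continuity with respect to Lebesgue measure *)

Section abs_continuity.
Context {R : realType} {d : nat}.
Notation T := 'rV[R]_d.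
Variable mu : probability T R.

Lemma convol_indicE (A : set T) x : measurable A ->
  (convol mu \1_A x)%:E = mu [set y | A (x + y)].
Proof.
move=> mA; have mAx := measurable_translate_set x mA.
rewrite /convol (_ : (fun y => _) = \1_[set y | A (x + y)]).
  rewrite Rintegral_indic_fine// fineK//; exact: fin_num_measure.
by apply/funext => y; exact: (indic_preimage _ _ (fun y => x + y)).
Qed.

Lemma measurable_addr_prod : measurable_fun setT (fun z : T * T => z.1 + z.2).
Proof.
apply: measurable_fun_rV => i; under eq_fun do rewrite mxE.
apply: measurable_funD.
- apply: (measurableT_comp (@measurable_coord R d i)); exact: measurable_fst.
- apply: (measurableT_comp (@measurable_coord R d i)); exact: measurable_snd.
Qed.

(** Tonelli on the set of pairs with [x + y] in [A]: its sections at fixed [y] are translates of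
    [A], hence null. *)
Lemma integral_translates_lebesgue (A : set T) : measurable A ->
  lebesgue_rV A = 0%E ->
  (\int[@lebesgue_rV R d]_x mu [set y | A (x + y)%R] = 0)%E.
Proof.
move=> mA A0.
pose B : set (T * T) := [set z | A (z.1 + z.2)].
have mB : measurable B.
  by rewrite -[B]setTI; exact: measurable_addr_prod.
have h := indic_fubini_tonelli (@lebesgue_rV R d) mu mB.
transitivity (\int[@lebesgue_rV R d]_x fubini_F mu (EFin \o \1_B) x)%E.
  apply: eq_integral => x _.
  rewrite /fubini_F (eq_integral (fun y => (\1_[set y | A (x + y)%R] y)%:E)).
    by rewrite integral_indic// ?setIT//; exact: measurable_translate_set.
  by move=> y _; congr EFin; exact: (indic_preimage _ B (fun y => (x, y))).
apply: etrans h _; apply: integral0_eq => y _.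
have mAy : measurable ((fun x : T => x + y) @^-1` A).
  by rewrite -[X in measurable X]setTI; exact: measurable_shift_rV.
rewrite /fubini_G (eq_integral (fun x => (\1_((fun x : T => (x + y)%R) @^-1` A) x)%:E)).
  rewrite integral_indic// setIT; exact: etrans (lebesgue_rV_shift y mA) A0.
by move=> x _; congr EFin; exact: (indic_preimage _ B (fun x => (x, y))).
Qed.

(** If [mu A = c > 0], continuity at 0 keeps [convol mu \1_A] above [c / 2] on a ball, so its
    Lebesgue integral is positive, against [integral_translates_lebesgue]. *)
Lemma convol_continuous_dominates :
  (forall A, measurable A -> continuous (convol mu \1_A)) ->
  forall A, measurable A -> lebesgue_rV A = 0%E -> mu A = 0%E.
Proof.
move=> cmu A mA A0; apply/eqP; rewrite -measure_le0 leNgt; apply/negP => muA.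
have muA' : mu A = (convol mu \1_A 0)%:E.
  by rewrite convol_indicE//; congr (mu _); apply/seteqP; split => y /=; rewrite add0r.
set c := convol mu \1_A 0.
have c0 : 0 < c by rewrite -lte_fin -muA'.
have c2 : 0 < c / 2 by rewrite divr_gt0.
have /cvgrPdist_le /(_ _ c2) /nbhs_ballP[r /= r0 hr] := cmu A mA 0.
have mb := measurable_ball_rV (0 : T) r.
have : ((c / 2)%:E * lebesgue_rV (ball (0%R : T) r) <= 0)%E.
  rewrite -(integral_translates_lebesgue mA A0).
  have -> : lebesgue_rV (ball (0%R : T) r) =
      (\int[@lebesgue_rV R d]_x (\1_(ball (0%R : T) r) x)%:E)%E.
    by rewrite integral_indic// setIT.
  rewrite -ge0_integralZl//; last 2 first.
  - by apply/measurable_EFinP; exact: measurable_indic.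
  - by rewrite lee_fin ltW.
  apply: ge0_le_integral_nonmeasurable => x.
    by rewrite mule_ge0// lee_fin// ltW.
  rewrite indicE; have [xr|xr] := pselect (ball (0 : T) r x); last first.
    by rewrite memNset// mule0.
  rewrite mem_set// mule1 -convol_indicE// lee_fin.
  have := hr x xr; rewrite /= -/c ler_norml => /andP[h1 h2].
  by lra.
rewrite lebesgue_rV_ball// -EFinM lee_fin leNgt => /negP; apply.
by rewrite mulr_gt0// exprn_gt0// mulrn_wgt0.
Qed.

End abs_continuity.

(** * A Young function attached to a sequence of levels *)

Section staircase_young.
Context {R : realType}.
Variable N : nat -> R.
Hypothesis N1 : forall k, 1 <= N k.

(* Chosen so that its conjugate at [y] is at most [y] times the number of
   levels [N k] below [y]. *)
Definition staircase_young (a : R) : R :=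
  sup [set N k * Num.max (`|a| - k%:R) 0 | k in [set: nat]].

Local Notation Phi := staircase_young.

Let N0 k : 0 <= N k. Proof. exact: le_trans ler01 (N1 k). Qed.

(** A real [sup] bounds its set only if the set has an upper bound: terms with [k >= |a|] vanish,
    and the sum of [N i * |a|] dominates the finitely many others. *)
Lemma staircase_young_ub a k : N k * Num.max (`|a| - k%:R) 0 <= Phi a.
Proof.
apply: sup_ubound; last by exists k.
have [n an] : exists n : nat, `|a| < n%:R.
  exists (Num.truncn `|a|).+1; exact: truncnS_gt.
exists (\sum_(i < n) N i * `|a|) => _ [i _ <-].
have [ni|ni] := leqP n i.
  rewrite max_r ?mulr0; first by apply: sumr_ge0 => j _; rewrite mulr_ge0.
  by rewrite subr_le0 (le_trans (ltW an))// ler_nat.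
rewrite (bigD1 (Ordinal ni))//= (@le_trans _ _ (N i * `|a|))//.
  by rewrite ler_wpM2l// ge_max normr_ge0 andbT lerBlDr lerDl.
by rewrite lerDl; apply: sumr_ge0 => j _; rewrite mulr_ge0.
Qed.

Lemma staircase_young_le a M :
  (forall k, N k * Num.max (`|a| - k%:R) 0 <= M) -> Phi a <= M.
Proof.
move=> h; apply: ge_sup; first by exists (N 0%N * Num.max (`|a| - 0%:R) 0); exists 0%N.
by move=> _ [k _ <-].
Qed.

Lemma staircase_young_norm a : `|a| <= Phi a.
Proof.
apply: le_trans (staircase_young_ub a 0); rewrite subr0 max_l//.
by rewrite ler_peMl.
Qed.

Lemma staircase_young_ge0 a : 0 <= Phi a.
Proof. exact: le_trans (staircase_young_norm a). Qed.

Lemma staircase_young0 : Phi 0 = 0.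
Proof.
apply/eqP; rewrite eq_le staircase_young_ge0 andbT.
apply: staircase_young_le => k; by rewrite normr0 sub0r max_r ?mulr0// oppr_le0.
Qed.

Lemma staircase_young_eq0 a : Phi a = 0 <-> a = 0.
Proof.
split=> [Pa|->]; last exact: staircase_young0.
by apply/eqP; rewrite -normr_le0 -Pa staircase_young_norm.
Qed.

Lemma staircase_young_function : young_function Phi.
Proof.
split.
(* A supremum of convex functions is convex: the inequality is checked term by term. *)
- move=> t x y _ _; rewrite !convRE.
  change (Phi (t%:inum * x + (1 - t%:inum) * y) <=
    t%:inum * Phi x + (1 - t%:inum) * Phi y).
  have s0 : 0 <= t%:inum :> R by [].
  have s1 : 0 <= 1 - t%:inum :> R by rewrite subr_ge0.
  set s : R := t%:inum in s0 s1 *.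
  apply: staircase_young_le => k.
  apply: (@le_trans _ _ (s * (N k * Num.max (`|x| - k%:R) 0) +
      (1 - s) * (N k * Num.max (`|y| - k%:R) 0))); last first.
    by apply: lerD; rewrite ler_wpM2l// staircase_young_ub.
  rewrite (_ : s * _ + _ = N k * (s * Num.max (`|x| - k%:R) 0 +
    (1 - s) * Num.max (`|y| - k%:R) 0)); last by ring.
  rewrite ler_wpM2l// ge_max; apply/andP; split.
    apply: (@le_trans _ _ (s * (`|x| - k%:R) + (1 - s) * (`|y| - k%:R))).
      rewrite (_ : s * _ + _ = s * `|x| + (1 - s) * `|y| - k%:R); last by ring.
      rewrite lerD2r (le_trans (ler_normD _ _))// !normrM.
      by rewrite (ger0_norm s0) (ger0_norm s1).
    by apply: lerD; rewrite ler_wpM2l// le_max lexx.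
  by apply: addr_ge0; rewrite mulr_ge0// le_max lexx orbT.
- by move=> x; rewrite /staircase_young normrN.
- exact: staircase_young0.
- apply/cvgryPge => A; near=> x.
  apply: le_trans (le_trans (ler_norm x) (staircase_young_norm x)).
  by near: x; apply: nbhs_pinfty_ge; exact: num_real.
Unshelve. all: by end_near. Qed.

(** The number of levels below [y], possibly infinite. As a series of indicators it can be
    integrated term by term, producing tail probabilities of the density. *)
Definition count_below (y : R) : \bar R :=
  (\sum_(0 <= k <oo) (\1_[set z : R | N k < z] y)%:E)%E.

Lemma count_below_ge0 y : (0 <= count_below y)%E.
Proof. by apply: nneseries_ge0 => k _ _; rewrite lee_fin. Qed.

Lemma measurable_count_below : measurable_fun setT count_below.
Proof.
apply: ge0_emeasurable_sum => k *; first by rewrite lee_fin.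
apply/measurable_EFinP/measurable_indic.
rewrite (_ : [set z | _] = `]N k, +oo[%classic); first exact: measurable_itv.
by apply/seteqP; split => z; rewrite /= in_itv/= andbT.
Qed.

Lemma count_below_ge (y : R) m : (forall k, (k < m)%N -> N k < y) ->
  (m%:R%:E <= count_below y)%E.
Proof.
move=> h; apply: (@le_trans _ _ (\sum_(0 <= k < m) (\1_[set z : R | N k < z] y)%:E)%E).
  rewrite sumEFin lee_fin big_mkord (eq_bigr (fun=> 1)).
    by rewrite sumr_const card_ord.
  by move=> i _; rewrite indicE mem_set//=; exact: h.
by apply: nneseries_lim_ge => k _ _; rewrite lee_fin.
Qed.

Lemma staircase_conjugate_le (y : R) : 0 <= y ->
  (young_conjugate Phi y <= y%:E * count_below y)%E.
Proof.
move=> y0; apply: ge_ereal_sup => _ [a /= a0 <-]; rewrite (ger0_norm y0).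
(* The least such [k], called [m], has [m] levels below [y], and
   [a y - Phi a <= m y] in both cases. *)
have P : exists k, (y <= N k) || (a <= k%:R).
  by exists (Num.truncn a).+1; rewrite (ltW (truncnS_gt a)) orbT.
have [m hm mmin] := ex_minnP P.
have hlt k : (k < m)%N -> N k < y.
  move=> km; rewrite ltNge; apply/negP => yk; have := mmin k.
  by rewrite yk leqNgt km => /(_ isT).
apply: (@le_trans _ _ (y * m%:R)%:E); last first.
  by rewrite EFinM; apply: lee_wpmul2l; [rewrite lee_fin|exact: count_below_ge].
(* If [a <= m], then [a y <= m y] and [Phi a >= 0]. Otherwise [y <= N m], and the term of index [m]
   gives [Phi a >= N m * (a - m) >= y * (a - m)]. *)
rewrite lee_fin; have [am|am] := leP a m%:R.
  rewrite (@le_trans _ _ (a * y))//; first by rewrite lerBlDr lerDl staircase_young_ge0.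
  by rewrite mulrC ler_wpM2l.
have {}hm : y <= N m by move: hm; rewrite (leNgt a) am orbF.
have := staircase_young_ub a m; rewrite (ger0_norm a0) max_l ?subr_ge0 ?(ltW am)// => h.
have : y * (a - m%:R) <= N m * (a - m%:R) by rewrite ler_wpM2r// subr_ge0 ltW.
lra.
Qed.

End staircase_young.

(** * The density and its Orlicz bound *)

Section density.
Context {R : realType} {d : nat}.
Notation T := 'rV[R]_d.
Variable mu : probability T R.
Hypothesis mu_leb : mu `<< @lebesgue_rV R d.

(** The Radon-Nikodym derivative is finite everywhere, so [fine] loses nothing. *)
Lemma probability_density : exists q : T -> R,
  [/\ measurable_fun setT q, forall x, 0 <= q x &
   forall f : T -> \bar R, measurable_fun setT f -> (forall x, 0 <= f x)%E ->
     (\int[mu]_x f x = \int[@lebesgue_rV R d]_x (f x * (q x)%:E))%E].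
Proof.
pose p := Radon_Nikodym_SigmaFinite.f mu (@lebesgue_rV R d).
have p0 := Radon_Nikodym_SigmaFinite.f_ge0 mu_leb.
have pfin := Radon_Nikodym_SigmaFinite.f_fin_num mu_leb.
have mp : measurable_fun setT p.
  exact: measurable_int (Radon_Nikodym_SigmaFinite.f_integrable mu_leb).
exists (fine \o p); split.
- exact: measurableT_comp.
- by move=> x; exact: fine_ge0.
move=> f mf f0.
rewrite -(Radon_Nikodym_SigmaFinite.change_of_variables mu_leb f0 measurableT mf).
by apply: eq_integral => x _; rewrite /= fineK.
Qed.

Lemma tail_levels (q : T -> R) (e : R) : measurable_fun setT q -> 0 < e ->
  exists2 N : R, 1 <= N & (mu [set x | (N < q x)%R] <= e%:E)%E.
Proof.
move=> mq e0.
have mB n : measurable [set x | n.+1%:R < q x].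
  rewrite (_ : [set x | _] = q @^-1` `]n.+1%:R, +oo[%classic).
    by rewrite -[X in measurable X]setTI; apply: mq => //; exact: measurable_itv.
  by apply/seteqP; split => z; rewrite /= in_itv/= andbT.
have cap0 : \bigcap_n [set x | n.+1%:R < q x] = set0.
  apply/seteqP; split => // x /(_ (Num.truncn (q x)) I) /=.
  by rewrite ltNge ltW// truncnS_gt.
have := @nonincreasing_cvg_mu _ _ _ mu (fun n => [set x | n.+1%:R < q x]).
rewrite cap0 measure0 => /(_ _ _ _ _)/wrap[].
- by apply: le_lt_trans (probability_le1 mu _) _; rewrite ?ltry.
- exact: mB.
- exact: measurable0.
- move=> m n mn; apply/subsetPset => x /=; apply: le_lt_trans.
  by rewrite ler_nat.
move=> /(cvge0_near_le e0)[N _ /(_ N (leqnn N)) /= hN].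
by exists N.+1%:R => //; rewrite ler1n.
Qed.

Lemma orlicz_bound_of_density : exists Phi : R -> R,
  [/\ young_function Phi, forall x, 0 <= Phi x, forall x, Phi x = 0 <-> x = 0 &
   forall u : T -> R, measurable_fun setT u ->
     (sup_norm (convol mu u) <= orlicz_norm Phi u)%E].
Proof.
have [q [mq q0 muq]] := probability_density.
have /choice[N hN] : forall k : nat, exists N : R, 1 <= N /\
    (mu [set x | (N < q x)%R] <= (1 / (2 ^ k.+1)%:R)%:E)%E.
  move=> k; have e0 : 0 < 1 / (2 ^ k.+1)%:R :> R.
    by rewrite divr_gt0// ltr0n expn_gt0.
  by have [N N1 h] := tail_levels mq e0; exists N.
have N1 k : 1 <= N k by case: (hN k).
exists (staircase_young N); split.
- exact: staircase_young_function.
- exact: staircase_young_ge0.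
- exact: staircase_young_eq0.
move=> u mu_; apply: ge_ereal_sup => _ [x _ <-].
(* A measurable majorant of the conjugate at [q z], by [staircase_conjugate_le]. *)
pose W z := ((q z)%:E * count_below N (q z))%E.
have mH : measurable_fun setT (fun z => count_below N (q z)).
  exact: measurableT_comp (measurable_count_below N) mq.
have mW : measurable_fun setT W.
  by apply: emeasurable_funM => //; exact/measurable_EFinP.
have W0 z : (0 <= W z)%E by rewrite mule_ge0// ?lee_fin// count_below_ge0.
have mtail k : measurable [set x | N k < q x].
  rewrite (_ : [set x | _] = q @^-1` `]N k, +oo[%classic).
    by rewrite -[X in measurable X]setTI; apply: mq => //; exact: measurable_itv.
  by apply/seteqP; split => z; rewrite /= in_itv/= andbT.
(* The factor [q] turns the Lebesgue integral into one against [mu]; the sum of the tail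
   probabilities is at most the sum of [2^-(k+1)], which is 1. *)
have W1 : (\int[@lebesgue_rV R d]_z W z <= 1)%E.
  rewrite /W; under eq_integral do rewrite muleC.
  rewrite -muq//; last by move=> z; exact: count_below_ge0.
  rewrite /count_below integral_nneseries//; last first.
  - move=> k; apply/measurable_EFinP.
    apply: (measurableT_comp _ mq); apply: measurable_indic.
    rewrite (_ : [set z | _] = `]N k, +oo[%classic); first exact: measurable_itv.
    by apply/seteqP; split => z; rewrite /= in_itv/= andbT.
  apply: (@le_trans _ _ (\sum_(0 <= k <oo) (1 / (2 ^ k.+1)%:R)%:E)%E); last first.
    exact: epsilon_trick0.
  apply: lee_nneseries => [k _ _|k _].
    by apply: integral_ge0 => z _; rewrite lee_fin.
  have [_] := hN k; apply: le_trans.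
  rewrite (eq_integral (fun x => (\1_[set x | N k < q x] x)%:E)).
    by rewrite integral_indic// setIT.
  by move=> y _; congr EFin; exact: (indic_preimage R [set z | N k < z] q).
(* The translated density is an admissible test function in [orlicz_norm], by translation
   invariance. *)
pose g z := q (z - x).
have mg : measurable_fun setT g.
  by apply: measurableT_comp => //; exact: measurable_shift_rV.
have g1 : (\int[@lebesgue_rV R d]_z young_conjugate (staircase_young N) (g z) <= 1)%E.
  apply: le_trans W1; rewrite -(integral_lebesgue_rV_shift (- x) mW W0).
  apply: ge0_le_integral_nonmeasurable => z.
    apply: young_conjugate_ge0; first exact: staircase_young0.
  exact: (staircase_conjugate_le N1 (q0 (z - x))).
apply: (@le_trans _ _ (\int[@lebesgue_rV R d]_z `|u z * g z|%:E)%E); last first.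
  by apply: ereal_sup_ubound; exists g.
have mux := measurable_comp_translate x mu_.
have mux' : measurable_fun setT (fun y => `|u (x + y)|%:E).
  by apply/measurable_EFinP; exact: measurableT_comp.
apply: (@le_trans _ _ (\int[mu]_y `|u (x + y)%R|%:E)%E).
  rewrite /convol /Rintegral.
  have mue : measurable_fun setT (fun y => (u (x + y))%:E) by exact/measurable_EFinP.
  apply: le_trans (le_abse_integral mu measurableT mue).
  (* As [u] is merely measurable, the integral may be infinite; [fine] then returns 0 and the bound
     is trivial. *)
  by case: (\int[mu]_y _)%E => [r||] //=; rewrite ?normr0 leey.
rewrite muq//.
have mug : measurable_fun setT (fun z => `|u z * g z|%:E).
  by apply/measurable_EFinP; apply: measurableT_comp => //; exact: measurable_funM.
rewrite -(integral_lebesgue_rV_shift x mug); last by move=> z; rewrite lee_fin.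
rewrite le_eqVlt; apply/orP; left; apply/eqP; apply: eq_integral => y _.
by rewrite -EFinM /g addrK addrC normrM (ger0_norm (q0 y)).
Qed.

End density.

(** * The equivalence *)

Theorem corollary3p2 (R : realType) (dO : measure_display)
    (Omega : measurableType dO) (P : probability Omega R) (d : nat)
    (X : R -> {RV P >-> 'rV[R]_d}) (hX : levy_process X) :
  strong_feller X <->
  (forall t : R, 0 < t ->
    exists (Phi : R -> R) (C : R),
      young_function Phi /\
      (forall x, 0 <= Phi x) /\
      (forall x, Phi x = 0 <-> x = 0) /\
      (forall u : 'rV[R]_d -> R, Cc_infty u ->
        (sup_norm (transition X t u) <= C%:E * orlicz_norm Phi u)%E)).
Proof.
split=> [sf t t0|h t t0 f mf bf].
  (* By definition [transition X t] is [convol] of the law of [X t], so the results on a single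
     probability measure apply. *)
  have cmu A : measurable A -> continuous (convol (distribution P (X t)) \1_A).
    move=> mA; have mI : measurable_fun setT (\1_A : _ -> R) by exact: measurable_indic.
    have bI : bounded_fun (\1_A : 'rV[R]_d -> R).
      apply/bounded_funP_ex; exists 1 => x.
      by rewrite indicE; case: (_ \in _); rewrite ?normr1// normr0 ler01.
    by have [_] := sf t t0 _ mI bI.
  have dom : distribution P (X t) `<< @lebesgue_rV R d.
    apply/null_content_dominatesP => A mA A0.
    exact: convol_continuous_dominates cmu A mA A0.
  have [Phi [yPhi Phi0 Phi_eq0 hu]] := orlicz_bound_of_density dom.
  exists Phi, 1; split => //; split => //; split => // u [Cu _].
  by rewrite mul1e; apply: hu; exact: measurable_continuous (Cu 0%N).
have [Phi [C [yPhi [Phi0 [_ hu]]]]] := h t t0.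
have domu : unif_dominated (distribution P (X t)).
  by apply: (unif_dominated_orlicz (young_0 yPhi) Phi0 (C := C)) => u Cu; exact: hu.
have /bounded_funP_ex[M fM] := bf; split.
  by apply/bounded_funP_ex; exists M; exact: convol_bounded.
exact: continuous_convol_measurable fM.
Qed.
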